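(* Let $n \in \mathbb{N}$, $n \geq 2$, let $\mathcal{AJ}_{n}$ be the annular Jones monoid of degree $n$, let $\rho_{n}$ be the partition of degree $n$ with blocks $\{n, 1'\}$ and $\{i, (i+1)'\}$ for $i \in \{1,\ldots,n-1\}$, and let $\mathbb{P}_{n}$ be the set of primes that divide $n$. Then the maximal subsemigroups of $\mathcal{AJ}_{n}$ are precisely: (a) $(\mathcal{AJ}_{n} \setminus \langle\rho_{n}\rangle) \cup \langle\rho_{n}^{d}\rangle$, where $d \in \mathbb{P}_{n}$ (type (M5)); and (b) $\mathcal{AJ}_{n} \setminus \{\alpha \in \mathcal{AJ}_{n} : \operatorname{rank}(\alpha) = n - 2\}$ (type (M1)). In particular, for $n \geq 2$ there are $|\mathbb{P}_{n}| + 1$ maximal subsemigroups of $\mathcal{AJ}_{n}$.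
   Context: $\mathbb{N}=\{1,2,3,\ldots\}$. A maximal subsemigroup of a semigroup $S$ is a proper subsemigroup not contained in any other proper subsemigroup; $\langle\cdot\rangle$ denotes the generated subsemigroup. A partition of degree $n$ is an equivalence relation on $\{1,\ldots,n\}\cup\{1',\ldots,n'\}$; its classes are called blocks; a block is transverse if it contains both unprimed and primed points. The rank of a partition is its number of transverse blocks. The product $\alpha\beta$: replace each $i'$ by $i''$ in $\alpha$ to get $\alpha'$, replace each $i$ by $i''$ in $\beta$ to get $\beta'$; let $(\alpha\beta)'$ be the smallest equivalence on $\{1,\ldots,n\}\cup\{1',\ldots,n'\}\cup\{1'',\ldots,n''\}$ containing $\alpha'\cup\beta'$; then $\alpha\beta$ is the restriction of $(\alpha\beta)'$ to $\{1,\ldots,n\}\cup\{1',\ldots,n'\}$. Order the points by $n'<(n-1)'<\cdots<1'<1<2<\cdots<n$; $\alpha$ is planar if there do not exist distinct blocks $A,X$ of $\alpha$ and points $a,b\in A$, $x,y\in X$ with $a<x<b<y$. A partition $\alpha$ is annular if $\alpha=\rho_n^k\beta\rho_n^l$ for some planar partition $\beta$ of degree $n$ and some $k,l\in\mathbb{Z}$ (note $\rho_n^n$ is the identity). $\mathcal{AJ}_n$ is the monoid of annular partitions of degree $n$ all of whose blocks have size exactly $2$; its group of units is $\langle\rho_n\rangle$, cyclic of order $n$. Types: a maximal subsemigroup $M$ of a finite monoid $S$ arises from the $\mathscr{J}$-class $J$ if $S\setminus M\subseteq J$; when $J$ is regular, $M$ has type (M1) if $M\cap J=\varnothing$, and (M5)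 if $M\cap J$ meets every $\mathscr{H}$-class of $J$. *)

(* Defs.v *)
From HB Require Import structures.
From mathcomp Require Import all_boot all_order all_fingroup all_algebra.
From mathcomp Require Import boolp.

Set Implicit Arguments.
Unset Strict Implicit.
Unset Printing Implicit Defensive.

Local Open Scope group_scope.

(* Indices are shifted by one: [inl i] is the point i+1, [inr i] is (i+1)'. *)
Notation point n := ('I_n + 'I_n)%type.

Record bipart (n : nat) : Type := Bipart {
  blocks :> {set {set point n}};
  blocksP : partition blocks [set: point n] }.
HB.instance Definition _ n := [isSub for @blocks n].
HB.instance Definition _ n := [Finite of bipart n by <:].

Definition same n (a : bipart n) (x y : point n) : bool :=
  y \in pblock (blocks a) x.

Lemma of_equiv_subproof n (e : rel (point n)) (eP : equivalence_rel e) :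
  partition (equivalence_partition e setT) [set: point n].
Proof. by apply: equivalence_partitionP => x y z _ _ _; apply: eP. Qed.

Definition of_equiv n (e : rel (point n)) (eP : equivalence_rel e) : bipart n :=
  Bipart (of_equiv_subproof eP).

(* The points of the three rows occurring in a product: [inl (inl i)] is
   unprimed, [inl (inr i)] is primed and [inr i] is double-primed. *)
Notation point3 n := (point n + 'I_n)%type.

Definition prime_to_dprime n (x : point n) : point3 n :=
  match x with inl i => inl (inl i) | inr i => inr i end.
Definition unprimed_to_dprime n (x : point n) : point3 n :=
  match x with inl i => inr i | inr i => inl (inr i) end.

Definition glue n (a b : bipart n) : rel (point3 n) := fun u v =>
  [exists x, exists y, [&& same a x y,
     u == prime_to_dprime x & v == prime_to_dprime y]]
  || [exists x, exists y, [&& same b x y,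
     u == unprimed_to_dprime x & v == unprimed_to_dprime y]].

Lemma same_equiv n (a : bipart n) : equivalence_rel (same a).
Proof.
by move=> x y z; apply: (pblock_equivalence (blocksP a)); rewrite inE.
Qed.

Lemma samexx n (a : bipart n) x : same a x x.
Proof. by case: (same_equiv a x x x). Qed.

Lemma same_sym n (a : bipart n) : symmetric (same a).
Proof.
have H x y : same a x y -> same a y x.
  by move=> xy; case: (same_equiv a x y x) => _ /(_ xy) <-; apply: samexx.
by move=> x y; apply/idP/idP; apply: H.
Qed.

Lemma glue_sym n (a b : bipart n) : symmetric (glue a b).
Proof.
have H u v : glue a b u v -> glue a b v u.
  case/orP=> /existsP[x] /existsP[y] /and3P[s /eqP-> /eqP->];
    apply/orP; [left | right];
    by apply/existsP; exists y; apply/existsP; exists x;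
       rewrite same_sym s !eqxx.
by move=> u v; apply/idP/idP; apply: H.
Qed.

(* [connect (glue a b)] is the reflexive transitive closure of the symmetric
   relation [glue a b], i.e. the least equivalence that contains it. *)
Definition mul_rel n (a b : bipart n) : rel (point n) := fun x y =>
  connect (glue a b) (inl x) (inl y).

Lemma mul_rel_equiv n (a b : bipart n) : equivalence_rel (mul_rel a b).
Proof.
move=> x y z; split=> [|xy]; first exact: connect0.
exact: (same_connect (sym_connect_sym (glue_sym a b))).
Qed.

Definition bip_mul n (a b : bipart n) : bipart n :=
  of_equiv (mul_rel_equiv a b).

Lemma graph_subproof n (f : 'I_n -> 'I_n) (f_inj : injective f) :
  partition [set [set inl i; inr (f i)] | i : 'I_n] [set: point n].
Proof.
apply/and3P; split.
- apply/eqP/setP=> x; rewrite inE; apply/bigcupP.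
  case: x => [i|j].
    exists [set inl i; inr (f i)]; first exact: imset_f.
    by rewrite !inE eqxx.
  have [g _ fK] := injF_bij f_inj.
  exists [set inl (g j); inr (f (g j))]; first exact: imset_f.
  by rewrite !inE fK eqxx orbT.
- apply/trivIsetP=> _ _ /imsetP[i _ ->] /imsetP[j _ ->] nij.
  apply/pred0P=> -[k|k]; rewrite /= !inE.
    apply/negP=> /andP[/orP[]/eqP // [->] /orP[]/eqP // [E]].
    by rewrite E eqxx in nij.
  apply/negP=> /andP[/orP[]/eqP // [->] /orP[]/eqP // [/f_inj E]].
  by rewrite E eqxx in nij.
- by apply/imsetP=> -[i _ /setP/(_ (inl i))]; rewrite !inE eqxx.
Qed.

Definition graph n (f : 'I_n -> 'I_n) (f_inj : injective f) : bipart n :=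
  Bipart (graph_subproof f_inj).

Definition bip_one n : bipart n := graph (@inj_id 'I_n).

Definition flip n (x : point n) : point n :=
  match x with inl i => inr i | inr i => inl i end.

Lemma star_equiv n (a : bipart n) :
  equivalence_rel (fun x y => same a (flip x) (flip y)).
Proof. by move=> x y z; apply: same_equiv. Qed.

(* The involution of the partition monoid that interchanges i and i'. On the
   graph of a permutation it is inversion, see [graphV]. *)
Definition bip_star n (a : bipart n) : bipart n := of_equiv (star_equiv a).

(* A pair (A, B) is saturated for a when the union of A and B' is a union of
   blocks of a. The saturated pairs determine a, and the product of partitions
   corresponds to the composition of these relations, see [sat_mul]. *)
Definition pair_mem n (A B : {set 'I_n}) (x : point n) : bool :=
  match x with inl i => i \in A | inr i => i \in B end.
Definition sat n (a : bipart n) (A B : {set 'I_n}) : Prop :=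
  forall x y, same a x y -> pair_mem A B x = pair_mem A B y.

Lemma same_of_equiv n e eP x y : same (@of_equiv n e eP) x y = e x y.
Proof.
rewrite /same /= pblock_equivalence_partition ?inE //.
Qed.

Lemma blocksE n (a : bipart n) :
  blocks a = equivalence_partition (same a) [set: point n].
Proof.
by rewrite -[LHS](equivalence_partition_pblock (blocksP a)).
Qed.

Lemma bip_eq n (a b : bipart n) : same a =2 same b -> a = b.
Proof.
move=> ab; apply: val_inj; rewrite /= !blocksE.
apply: eq_imset => x; apply/setP=> y; rewrite !inE /=; exact: ab.
Qed.

Lemma same_sat n (a : bipart n) x y :
  same a x y <-> (forall A B, sat a A B -> pair_mem A B x = pair_mem A B y).
Proof.
split=> [xy A B| H]; first exact.
pose A := [set i | same a x (inl i)]; pose B := [set i | same a x (inr i)].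
have E z : pair_mem A B z = same a x z by case: z => i /=; rewrite inE.
rewrite -E -(H A B) ?E ?samexx // => u v uv; rewrite !E ![same a x _]same_sym.
by case: (same_equiv a u v x) => _ /(_ uv).
Qed.

Lemma sat_inj n (a b : bipart n) :
  (forall A B, sat a A B <-> sat b A B) -> a = b.
Proof.
move=> ab; apply: bip_eq => x y.
by apply/idP/idP => /same_sat H; apply/same_sat=> A B /ab; apply: H.
Qed.

Lemma sat_of_equiv n e eP A B :
  sat (@of_equiv n e eP) A B <->
  (forall x y, e x y -> pair_mem A B x = pair_mem A B y).
Proof.
by split=> H x y; [rewrite -(same_of_equiv eP) | rewrite same_of_equiv]; apply: H.
Qed.

Lemma connect_inv (T : finType) (e : rel T) (c : T -> bool) u v :
  (forall u v, e u v -> c u = c v) -> connect e u v -> c u = c v.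
Proof.
move=> H /connectP[p]; elim: p u => [|w p IH] u /=; first by move=> _ ->.
by case/andP=> /H-> ep /(IH _ ep).
Qed.

Lemma sat_mul n (a b : bipart n) A B :
  sat (bip_mul a b) A B <-> exists2 C, sat a A C & sat b C B.
Proof.
split=> [/sat_of_equiv H | [C aAC bCB]]; last first.
  apply/sat_of_equiv => x y; pose c u := match u with
    | inl (inl i) => i \in A | inl (inr i) => i \in B | inr i => i \in C end.
  have E z : pair_mem A B z = c (inl z) by case: z.
  rewrite !E.
  apply: connect_inv => u v /orP[] /existsP[{}x] /existsP[{}y]
    /and3P[s /eqP-> /eqP->].
    by move/aAC: s; case: x; case: y.
  by move/bCB: s; case: x; case: y.
pose c u := [exists x, pair_mem A B x && connect (glue a b) (inl x) u].
have cs := sym_connect_sym (glue_sym a b).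
have cinv u v : glue a b u v -> c u = c v.
  move=> uv; apply: eq_existsb => x.
  by rewrite (same_connect_r cs (connect1 uv)).
have cE x : c (inl x) = pair_mem A B x.
  apply/existsP/idP=> [[y /andP[yAB /H <-]] // | xAB].
  by exists x; rewrite xAB connect0.
exists [set i | c (inr i)] => x y s.
  have E z : pair_mem A [set i | c (inr i)] z = c (prime_to_dprime z).
    by case: z => i; rewrite /= ?inE // cE.
  rewrite !E; apply: cinv; apply/orP; left.
  by apply/existsP; exists x; apply/existsP; exists y; rewrite s !eqxx.
have E z : pair_mem [set i | c (inr i)] B z = c (unprimed_to_dprime z).
  by case: z => i; rewrite /= ?inE // cE.
rewrite !E; apply: cinv; apply/orP; right.
by apply/existsP; exists x; apply/existsP; exists y; rewrite s !eqxx.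
Qed.

Lemma sat_graph n f f_inj A B :
  sat (@graph n f f_inj) A B <-> A = f @^-1: B.
Proof.
have tI : trivIset (graph f_inj) by case/and3P: (blocksP (graph f_inj)).
have bP i : [set inl i; inr (f i)] \in blocks (graph f_inj) by apply: imset_f.
split=> [H | -> x y].
  apply/setP=> i; rewrite inE; apply: (H (inl i) (inr (f i))).
  by rewrite /same (def_pblock tI (bP i)) !inE eqxx ?orbT.
rewrite /same -eq_pblock //; last first.
  by rewrite (cover_partition (blocksP _)) inE.
have E z : pair_mem (f @^-1: B) B z =
    [exists i, (pblock (graph f_inj) z == [set inl i; inr (f i)])
               && (f i \in B)].
  have : pblock (graph f_inj) z \in blocks (graph f_inj).
    by rewrite pblock_mem // (cover_partition (blocksP _)) inE.
  case/imsetP=> i _ pE.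
  have zi : z \in [set inl i; inr (f i)].
    by rewrite -pE mem_pblock (cover_partition (blocksP _)) inE.
  transitivity (f i \in B).
    by move: zi; rewrite !inE => /orP[] /eqP->; rewrite /= ?inE.
  apply/idP/existsP=> [fiB | [j]]; first by exists i; rewrite pE eqxx.
  rewrite pE => /andP[/eqP/setP/(_ (inl i))]; rewrite !inE eqxx /= orbF.
  by move=> /esym/eqP[->].
by move/eqP=> xy; rewrite !E xy.
Qed.

Lemma sat_star n (a : bipart n) A B : sat (bip_star a) A B <-> sat a B A.
Proof.
have E C D x : pair_mem C D (@flip n x) = pair_mem D C x by case: x.
have K : involutive (@flip n) by case.
split=> [/sat_of_equiv H x y s | H].
  by rewrite -!(E A B); apply: H; rewrite !K.
by apply/sat_of_equiv=> x y /H; rewrite !E.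
Qed.

Lemma bip_mulA n : associative (@bip_mul n).
Proof.
move=> a b c; apply: sat_inj => A B; split.
  case/sat_mul=> C aC /sat_mul[D bD cD].
  by apply/sat_mul; exists D => //; apply/sat_mul; exists C.
case/sat_mul=> D /sat_mul[C aC bD] cD.
by apply/sat_mul; exists C => //; apply/sat_mul; exists D.
Qed.

Lemma bip_mul1 n : left_id (bip_one n) (@bip_mul n).
Proof.
move=> a; apply: sat_inj => A B; split.
  case/sat_mul=> C /sat_graph->.
  by have -> : id @^-1: C = C by apply/setP=> i; rewrite inE.
move=> aAB; apply/sat_mul; exists A => //.
by apply/sat_graph/setP=> i; rewrite inE.
Qed.

Lemma bip_starK n : involutive (@bip_star n).
Proof.
move=> a; apply: sat_inj => A B.
by split=> [/sat_star/sat_star // | ?]; apply/sat_star/sat_star.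
Qed.

Lemma bip_starM n :
  {morph @bip_star n : a b / bip_mul a b >-> bip_mul b a}.
Proof.
move=> a b; apply: sat_inj => A B; split.
  case/sat_star/sat_mul=> C aC bC.
  by apply/sat_mul; exists C; apply/sat_star.
case/sat_mul=> C /sat_star aC /sat_star bC.
by apply/sat_star/sat_mul; exists C.
Qed.

HB.instance Definition _ n := isStarMonoid.Build (bipart n)
  (@bip_mulA n) (@bip_mul1 n) (@bip_starK n) (@bip_starM n).

Lemma graphM n f g (f_inj : injective f) (g_inj : injective g) :
  graph f_inj * graph g_inj = graph (inj_comp g_inj f_inj) :> bipart n.
Proof.
apply: sat_inj => A B; split.
  case/sat_mul=> C /sat_graph-> /sat_graph->.
  by apply/sat_graph/setP=> i; rewrite !inE.
move/sat_graph->; apply/sat_mul; exists (g @^-1: B); apply/sat_graph => //.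
by apply/setP=> i; rewrite !inE.
Qed.

Lemma graphV n f g (f_inj : injective f) (g_inj : injective g) :
  cancel f g -> (graph f_inj)^-1 = graph g_inj :> bipart n.
Proof.
move=> fK; have gK : cancel g f by move=> x; apply: g_inj; rewrite fK.
apply: sat_inj => A B; split.
  by move/sat_star/sat_graph->; apply/sat_graph/setP=> i; rewrite !inE gK.
by move/sat_graph->; apply/sat_star/sat_graph/setP=> i; rewrite !inE fK.
Qed.

(* Meaningful for units a with inverse a^-1, such as [rho n]. *)
Definition bip_exp n (a : bipart n) (k : int) : bipart n :=
  match k with Posz m => a ^+ m | Negz m => a ^- m.+1 end.

Definition rho n : bipart n := graph (@ordS_inj n).

Lemma rhoV n : rho n * (rho n)^-1 = 1.
Proof.
rewrite (graphV _ (@ord_pred_inj n) (@ordSK n)) graphM.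
apply: sat_inj => A B; split=> /sat_graph->; apply/sat_graph/setP=> i;
  by rewrite !inE /= ordSK.
Qed.

Lemma Vrho n : (rho n)^-1 * rho n = 1.
Proof.
rewrite (graphV _ (@ord_pred_inj n) (@ordSK n)) graphM.
apply: sat_inj => A B; split=> /sat_graph->; apply/sat_graph/setP=> i;
  by rewrite !inE /= ord_predK.
Qed.

Definition transverse n (B : {set point n}) : bool :=
  [exists i, inl i \in B] && [exists i, inr i \in B].

Definition bip_rank n (a : bipart n) : nat :=
  #|[set B in blocks a | transverse B]|.

(* The position of a point in the order n' < ... < 1' < 1 < ... < n. *)
Definition position n (x : point n) : nat :=
  match x with inl i => n + i | inr i => n - i.+1 end.

Definition planar n (a : bipart n) : Prop :=
  ~ exists A X : {set point n},
      [/\ A \in blocks a, X \in blocks a, A != X &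
          exists p q x y,
            [/\ p \in A, q \in A, x \in X, y \in X &
                [&& position p < position x, position x < position q
                  & position q < position y]]].

Definition annular n (a : bipart n) : Prop :=
  exists (b : bipart n) (k l : int),
    planar b /\ a = bip_exp (rho n) k * b * bip_exp (rho n) l.

Definition AJ n : {set bipart n} :=
  [set a | `[< annular a >] & [forall B in blocks a, #|B| == 2]].

Definition subsemigroup n (S T : {set bipart n}) : bool :=
  [&& T != set0, T \subset S & T * T \subset T].

Definition sgen n (A : {set bipart n}) : {set bipart n} :=
  \bigcap_(T : {set bipart n} | (A \subset T) && subsemigroup setT T) T.

Definition maximal_subsemigroup n (S M : {set bipart n}) : bool :=
  maxset (fun T => subsemigroup S T && (T \proper S)) M.

(* Green's relations of a submonoid S; principal ideals are taken in S, and
   need no adjoined identity because S contains one. *)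
Definition green_L n (S : {set bipart n}) : rel (bipart n) := fun a b =>
  S * [set a] == S * [set b].
Definition green_R n (S : {set bipart n}) : rel (bipart n) := fun a b =>
  [set a] * S == [set b] * S.
Definition green_H n (S : {set bipart n}) : rel (bipart n) := fun a b =>
  green_L S a b && green_R S a b.
Definition green_J n (S : {set bipart n}) : rel (bipart n) := fun a b =>
  S * [set a] * S == S * [set b] * S.

Definition J_classes n (S : {set bipart n}) : {set {set bipart n}} :=
  equivalence_partition (green_J S) S.
Definition H_classes n (S : {set bipart n}) : {set {set bipart n}} :=
  equivalence_partition (green_H S) S.

Definition regular n (S J : {set bipart n}) : bool :=
  [forall a in J, exists x in S, a * x * a == a].

Definition arises_from n (S M J : {set bipart n}) : bool :=
  (J \in J_classes S) && (S :\: M \subset J).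

Definition type_M1 n (S M : {set bipart n}) : bool :=
  [exists J, [&& arises_from S M J, regular S J & M :&: J == set0]].

Definition type_M5 n (S M : {set bipart n}) : bool :=
  [exists J, [&& arises_from S M J, regular S J &
    [forall H in H_classes S, (H \subset J) ==> (M :&: J :&: H != set0)]]].

(* Main.v *)
Require Import Defs.
From mathcomp Require Import all_boot all_order all_fingroup all_algebra.
From mathcomp Require Import boolp zify.

Set Implicit Arguments.
Unset Strict Implicit.
Unset Printing Implicit Defensive.

Local Open Scope group_scope.

(** Write S for AJ n and e for the hook with blocks {1, 2}, {1', 2'} and
    {i, i'} for i > 2. The classification rests on four facts.

    - S is the monoid generated by rho and e ([AJ_ind], [AJ_mul]).
    - An element of S is a power of rho or has rank at most n - 2; the rank of
      a product is at most the rank of each factor ([rank_lt_n], [rank_mulr],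
      [rank_mull]).
    - A subsemigroup of S that contains rho and some element of rank n - 2
      contains e, hence is S ([rank_n2_gen]).
    - If a subsemigroup T omits rho, then some prime divisor p of n divides
      every j such that rho ^ j lies in T ([cyclic_prime]).

    So a proper subsemigroup that contains rho has no element of rank n - 2 and
    lies in (b), while one that omits rho lies in the member of (a) given by p
    ([proper_sub_Mb], [proper_sub_Ma]). The subsemigroups in (a) and (b) are
    proper and pairwise incomparable, hence they are the maximal ones.

    A partition whose blocks have size 2 is handled through the fixed-point free
    involution f that swaps the two points of each block ([mates]). Multiplying
    on the right by the hook at i replaces the blocks of i' and (i+1)' by
    {i', (i+1)'} and {f i', f (i+1)'} ([mates_mul_hook]); as i' and (i+1)' are adjacent, planarity survives
    ([noncrossing_reconnect]).

    Planar matchings are products of hooks ([planar_ind]). One that is not the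
    identity has a cup {i', (i+1)'}. By parity some other string crosses the
    vertical line between columns i and i+1, and the one nearest to the cup can
    be cut and rejoined with the cup so as to give a planar matching whose
    product with the hook is the given one, and whose strings cover a smaller
    total horizontal distance ([exists_visible], [spread_split]).

    For S to be closed under products it suffices to multiply a planar matching
    by a hook. The only case that leaves the plane is the hook joining n' to 1'.
    There the annulus is cut along the string at 1' instead: rotating both rows
    by the points that this string encloses keeps the matching planar and moves
    the hook away from the cut ([noncrossing_rotate], [AJ_planar_last_hook]).

    For the third fact, an element of rank n - 2 is, up to powers of rho, of the
    form x = e x = x e. Counting through strings gives x x^-1 = e, where ^-1 is
    the involution of the partition monoid, and by finiteness some positive power
    of x equals e ([local_unit], [local_power]). *)

(** * Perfect matchings and their involutions *)

Lemma pblockE n (a : bipart n) x : pblock (blocks a) x = [set y | same a x y].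
Proof. by apply/setP => y; rewrite inE. Qed.

Lemma same_trans n (a : bipart n) y x z : same a x y -> same a y z -> same a x z.
Proof. by move=> xy; case: (same_equiv a x y z) => _ /(_ xy) ->. Qed.

Lemma mem_blocks n (a : bipart n) B :
  reflect (exists x, B = [set y | same a x y]) (B \in blocks a).
Proof.
apply: (iffP idP) => [Bin | [x ->]].
  case: (set_0Vmem B) => [B0|[x xB]].
    by case/and3P: (blocksP a) => _ _; rewrite -B0 Bin.
  exists x; rewrite -pblockE; apply/esym/def_pblock => //.
  by case/and3P: (blocksP a).
by rewrite -pblockE pblock_mem // (cover_partition (blocksP _)) inE.
Qed.

(** [mates a f]: the blocks of [a] are the pairs {x, f x}, with [f x != x]. *)
Definition mates n (a : bipart n) (f : point n -> point n) : Prop :=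
  (forall x, f x != x) /\ (forall x y, same a x y = (y == x) || (y == f x)).

Definition matching n (a : bipart n) : bool := [forall B in blocks a, #|B| == 2].

Lemma matesP n (a : bipart n) : reflect (exists f, mates a f) (matching a).
Proof.
apply: (iffP forall_inP) => [H | [f [nf fP]] B /mem_blocks[x ->]].
  have P x : exists2 y, [set z | same a x z] == [set x; y] & y != x.
    have Bx : [set y | same a x y] \in blocks a by apply/mem_blocks; exists x.
    have [u [v [uv E]]] := cards2P _ (H _ Bx).
    have : x \in [set y | same a x y] by rewrite inE samexx.
    rewrite E !inE => /orP[] /eqP xE.
      by exists v; rewrite ?E ?xE // eq_sym.
    by exists u; rewrite ?E xE // setUC.
  have P' x : exists y, ([set z | same a x z] == [set x; y]) && (y != x).
    by case: (P x) => y y1 y2; exists y; rewrite y1.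
  exists (fun x => xchoose (P' x)); split=> [x|x y].
    by case/andP: (xchooseP (P' x)).
  case/andP: (xchooseP (P' x)) => /eqP/setP/(_ y).
  by rewrite !inE.
have -> : [set y | same a x y] = [set x; f x].
  by apply/setP=> y; rewrite !inE fP.
by rewrite cards2 [x == _]eq_sym nf.
Qed.

Section Mates.
Variables (n : nat) (a : bipart n) (f : point n -> point n).
Hypothesis af : mates a f.

Lemma mates_neq x : f x != x. Proof. by case: af. Qed.
Lemma mates_same x y : same a x y = (y == x) || (y == f x).
Proof. by case: af. Qed.
Lemma mates_samef x : same a x (f x).
Proof. by rewrite mates_same eqxx orbT. Qed.
Lemma mates_inv : involutive f.
Proof.
move=> x; have := mates_samef x; rewrite same_sym mates_same.
by rewrite eq_sym (negPf (mates_neq x)) /= => /eqP.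
Qed.
Lemma mates_matching : matching a. Proof. by apply/matesP; exists f. Qed.
Lemma mates_sat A B :
  sat a A B <-> forall x, pair_mem A B (f x) = pair_mem A B x.
Proof.
split=> [H x | H x y]; first by apply/esym/H/mates_samef.
by rewrite mates_same => /orP[] /eqP ->.
Qed.
Lemma mates_pair x y : same a x y -> x != y -> f x = y.
Proof. by rewrite mates_same eq_sym => /orP[->//|/eqP->]. Qed.
Lemma mates_unique b g : mates b g -> f =1 g -> a = b.
Proof.
by case=> _ bg fg; apply: bip_eq => x y; rewrite mates_same bg fg.
Qed.
(** A matching that refines another partition into pairs is equal to it. *)
Lemma mates_sub b : matching b -> (forall x, same b x (f x)) -> a = b.
Proof.
case/matesP=> g bg H; apply: (mates_unique bg) => x.
by case: bg (H x) => _ ->; rewrite (negPf (mates_neq x)) => /eqP.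
Qed.
End Mates.

Lemma pairing_equiv (T : eqType) (f : T -> T) :
  involutive f -> equivalence_rel (fun x y => (y == x) || (y == f x)).
Proof.
move=> fK x y z; split; first by rewrite eqxx.
by case/orP=> /eqP-> //; rewrite fK orbC.
Qed.

Definition of_pairing n (f : point n -> point n) (fK : involutive f) : bipart n :=
  of_equiv (pairing_equiv fK).

Lemma mates_of_pairing n (f : point n -> point n) (fK : involutive f) :
  (forall x, f x != x) -> mates (of_pairing fK) f.
Proof. by move=> nf; split=> // x y; rewrite same_of_equiv. Qed.

(** The pairing obtained from [f] by joining [u] to [v], and joining the former
    partners [f u] and [f v] to each other. When [f u = v] it is [f]. *)
Definition reconnect (T : eqType) (f : T -> T) u v x :=
  if x == u then v else if x == v then u
  else if x == f u then f v else if x == f v then f u else f x.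

Section Reconnect.
Variables (T : eqType) (f : T -> T) (u v : T).
Hypotheses (fK : involutive f) (nf : forall x, f x != x) (uv : u != v).

Lemma reconnect_id : f u = v -> reconnect f u v =1 f.
Proof.
move=> fu x; rewrite /reconnect -fu fK.
by case: (eqVneq x u) => [->|_] //; case: (eqVneq x (f u)) => [->|_]; rewrite ?fK.
Qed.

Lemma reconnect_l : reconnect f u v u = v.
Proof. by rewrite /reconnect eqxx. Qed.
Lemma reconnect_r : reconnect f u v v = u.
Proof. by rewrite /reconnect eqxx; case: eqP. Qed.

Lemma reconnect_fl : f u != v -> reconnect f u v (f u) = f v.
Proof. by move=> fuv; rewrite /reconnect eqxx (negPf (nf u)) (negPf fuv). Qed.
Lemma reconnect_fr : f u != v -> reconnect f u v (f v) = f u.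
Proof.
move=> fuv; rewrite /reconnect eqxx (negPf (nf v)) (inj_eq (inv_inj fK)).
by rewrite (inv_eq fK) eq_sym (negPf fuv); case: eqP => // ->.
Qed.
Lemma reconnect_out x : x != u -> x != v -> x != f u -> x != f v ->
  reconnect f u v x = f x.
Proof. by rewrite /reconnect; do 4!move/negPf->. Qed.

Variant reconnect_spec x : T -> Type :=
| ReconnectL of x = u : reconnect_spec x v
| ReconnectR of x = v : reconnect_spec x u
| ReconnectFL of x = f u & f u != u & f u != v & f v != u : reconnect_spec x (f v)
| ReconnectFR of x = f v & f v != u & f v != v & f u != v : reconnect_spec x (f u)
| ReconnectOut of x != u & x != v & x != f u & x != f v
   & f x != u & f x != v & f x != f u & f x != f v : reconnect_spec x (f x).

Lemma reconnectP x : reconnect_spec x (reconnect f u v x).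
Proof.
rewrite /reconnect; case: (eqVneq x u) => [->|xu]; first by constructor.
case: (eqVneq x v) => [->|xv]; first by constructor.
case: (eqVneq x (f u)) xu xv => [->|xfu] xu xv.
  by constructor; rewrite // (inv_eq fK) eq_sym.
case: (eqVneq x (f v)) xu xv xfu => [->|xfv] xu xv xfu.
  by constructor; rewrite // (inv_eq fK) eq_sym.
by constructor; rewrite // ?(inj_eq (inv_inj fK)) // (inv_eq fK).
Qed.

Lemma reconnect_neq x : reconnect f u v x != x.
Proof.
case: reconnectP => [->|->|-> _ _ _|-> _ _ _|] //; rewrite ?(inj_eq (inv_inj fK)) //;
  by rewrite eq_sym.
Qed.

Lemma reconnectK : involutive (reconnect f u v).
Proof.
move=> x; case: (reconnectP x) => [->|->|->|->|].
- exact: reconnect_r.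
- exact: reconnect_l.
- by move=> _ ? _; apply: reconnect_fr.
- by move=> _ _ ?; apply: reconnect_fl.
by move=> *; rewrite reconnect_out.
Qed.
End Reconnect.

(** Reconnecting [u] to any [p] is undone by reconnecting [u] to its old
    partner. *)
Lemma reconnect_undo (T : eqType) (f : T -> T) u p :
  involutive f -> (forall x, f x != x) -> p != u -> p != f u ->
  reconnect (reconnect f u p) u (f u) =1 f.
Proof.
move=> fK nf pu pfu.
have up : u != p by rewrite eq_sym.
have fup : f u != p by rewrite eq_sym.
have ufu : u != f u by rewrite eq_sym.
move=> x; rewrite {1}/reconnect reconnect_l reconnect_fl //.
case: eqVneq => [->//|xu]; case: eqVneq => [->|xv]; first by rewrite fK.
case: eqVneq => [->//|xp]; case: eqVneq => [->|xfp]; first by rewrite fK.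
by rewrite reconnect_out.
Qed.

(** * Noncrossing pairings *)

Lemma position_inj n : injective (@position n).
Proof.
by move=> [i|i] [j|j] /= E; first [congr inl | congr inr | idtac];
  try (apply: val_inj => /=); have := ltn_ord i; have := ltn_ord j; lia.
Qed.

(** [c] lies strictly between [a] and [b], in whichever order they are. *)
Definition between (a b c : nat) : bool := ((a < c < b) || (b < c < a))%N.

Lemma betweenC a b c : between a b c = between b a c.
Proof. by rewrite /between orbC. Qed.

(** The points between [a] and [c] are, modulo 2, those between [a] and [b]
    together with those between [b] and [c]. *)
Lemma between_chain a b c z : z != a -> z != b -> z != c ->
  between a c z = between a b z (+) between b c z.
Proof. by rewrite /between; lia. Qed.

Definition separates n (x y z : point n) :=
  between (position x) (position y) (position z).

(** No block crosses another: each pair {x, f x} has both or none of the points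
    of any other pair between its own. *)
Definition noncrossing n (f : point n -> point n) :=
  forall x y, separates x (f x) (f y) = separates x (f x) y.

Lemma separatesC n (x y z : point n) : separates x y z = separates y x z.
Proof. exact: betweenC. Qed.

Lemma separates_ll n (x y : point n) : separates x y x = false.
Proof. by rewrite /separates /between; lia. Qed.

Lemma separates_rr n (x y : point n) : separates x y y = false.
Proof. by rewrite /separates /between; lia. Qed.

Lemma eq_position n (x y : point n) : (position x == position y) = (x == y).
Proof. by rewrite (inj_eq (@position_inj n)). Qed.

Lemma separates_chain n (a b c z : point n) : z != a -> z != b -> z != c ->
  separates a c z = separates a b z (+) separates b c z.
Proof. by rewrite -!eq_position; apply: between_chain. Qed.

Lemma separates_pairC n (a b c d : point n) :
  a != c -> a != d -> b != c -> b != d ->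
  separates a b c = separates a b d -> separates c d a = separates c d b.
Proof. by rewrite -!eq_position /separates /between; lia. Qed.

Lemma separates_adjacent n (u v a b : point n) :
  position u = (position v).+1 -> a != u -> a != v -> b != u -> b != v ->
  separates a b u = separates a b v.
Proof. by rewrite -!eq_position /separates /between; lia. Qed.

Lemma separates_adj n (u v z : point n) :
  position u = (position v).+1 -> separates u v z = false.
Proof. by rewrite /separates /between; lia. Qed.

Lemma noncrossing_ext n (f g : point n -> point n) :
  f =1 g -> noncrossing f -> noncrossing g.
Proof. by move=> fg H x y; rewrite -!fg. Qed.

Lemma planar_mates n (a : bipart n) f : mates a f ->
  planar a <-> noncrossing f.
Proof.
move=> af; have fK := mates_inv af; have nf := mates_neq af.
split=> [pl|nc].
  have H x y : (position x < position y)%N -> (position y < position (f x))%N ->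
      (position (f x) < position (f y))%N -> False.
    move=> h1 h2 h3; case: pl.
    exists [set z | same a x z], [set z | same a y z]; split.
    - by apply/mem_blocks; exists x.
    - by apply/mem_blocks; exists y.
    - apply/negP=> /eqP/setP/(_ x); rewrite !inE !(mates_same af) eqxx /=.
      by rewrite -(inv_eq fK) -!eq_position; lia.
    exists x, (f x), y, (f y).
    by rewrite !inE !(mates_same af) !eqxx !orbT h1 h2 h3.
  move=> x y.
  rewrite /separates /between.
  have := H x y; have := H x (f y); have := H (f x) y; have := H (f x) (f y).
  have := H y x; have := H y (f x); have := H (f y) x; have := H (f y) (f x).
  have := nf x; have := nf y; rewrite !fK -!eq_position.
  have : (position y == position x) = (position (f y) == position (f x)).
    by rewrite !eq_position (inj_eq (inv_inj fK)).
  have : (position y == position (f x)) = (position (f y) == position x).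
    by rewrite !eq_position (inv_eq fK).
  lia.
case=> A [X [/mem_blocks[x0 ->] /mem_blocks[y0 ->] ne [p [q [x [y [pA qA xX yX cr]]]]]]].
move: pA qA xX yX; rewrite !inE => pA qA xX yX.
have pq : f p = q.
  apply: (mates_pair af); first by apply: same_trans qA; rewrite same_sym.
  by rewrite -eq_position; lia.
have xy : f x = y.
  apply: (mates_pair af); first by apply: same_trans yX; rewrite same_sym.
  by rewrite -eq_position; lia.
by have := nc p x; rewrite pq xy /separates /between; lia.
Qed.

Lemma noncrossing_reconnect n (f : point n -> point n) u v :
  involutive f -> (forall x, f x != x) -> noncrossing f ->
  position u = (position v).+1 -> noncrossing (reconnect f u v).
Proof.
move=> fK nf nc adj.
have uv : u != v by rewrite -eq_position; lia.
case: (eqVneq (f u) v) => [fuv|fuv].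
  by apply: noncrossing_ext nc => x; rewrite reconnect_id.
have fvu : f v != u by rewrite (inv_eq fK) eq_sym.
(* the pair {f u, f v} separates the same points, modulo 2, as the two pairs
   {u, f u} and {v, f v} together *)
have new z : z != u -> z != v -> z != f u -> z != f v ->
    separates (f u) (f v) z = separates u (f u) z (+) separates v (f v) z.
  move=> zu zv zfu zfv.
  rewrite (@separates_chain _ _ u) // (@separates_chain _ u v) //.
  by rewrite (separates_adj _ adj) /= separatesC.
have newf z : z != u -> z != v -> z != f u -> z != f v ->
    separates (f u) (f v) (f z) = separates (f u) (f v) z.
  move=> zu zv zfu zfv.
  by rewrite !new ?nc ?(inj_eq (inv_inj fK)) ?(inv_eq fK).
have newu : separates (f u) (f v) u = separates (f u) (f v) v.
  exact: separates_adjacent.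
move=> x y.
case: (reconnectP u v fK x)
  => [->|->|-> _ _ _|-> _ _ _|xu xv xfu xfv fxu fxv fxfu fxfv].
- by rewrite !separates_adj.
- by rewrite ![separates v u _]separatesC !separates_adj.
- case: (reconnectP u v fK y) => [->|->|-> _ _ _|-> _ _ _|*];
  by rewrite ?separates_ll ?separates_rr ?newf.
- rewrite ![separates (f v) (f u) _]separatesC.
  case: (reconnectP u v fK y) => [->|->|-> _ _ _|-> _ _ _|*];
  by rewrite ?separates_ll ?separates_rr ?newf.
have E : separates x (f x) u = separates x (f x) v by apply: separates_adjacent.
case: (reconnectP u v fK y) => [->|->|-> _ _ _|-> _ _ _|*];
by rewrite ?nc ?E.
Qed.

(** Inverse of the previous operation: the cup {u, f u} of neighbours and a
    string {p, f p} are replaced by {u, p} and {f u, f p}. This stays noncrossing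
    as soon as both or none of the points of every other new pair lie between
    [u] and [p]. *)
Lemma noncrossing_split n (f : point n -> point n) u p :
  involutive f -> (forall x, f x != x) -> noncrossing f ->
  position u = (position (f u)).+1 -> p != u -> p != f u ->
  separates u p (f u) = separates u p (f p) ->
  (forall z, z != u -> z != f u -> z != p -> z != f p ->
    separates u p (f z) = separates u p z) ->
  noncrossing (reconnect f u p).
Proof.
move=> fK nf nc adj pu pfu H1 H2.
have up : u != p by rewrite eq_sym.
have fup : f u != p by rewrite eq_sym.
have ufp : u != f p by rewrite -(inv_eq fK).
have fufp : f u != f p by rewrite (inj_eq (inv_inj fK)).
have other z : z != u -> z != f u -> z != p -> z != f p ->
    separates (f u) (f p) (f z) = separates (f u) (f p) z.
  move=> zu zv zp zfp.
  have C a : a != u -> a != f u -> a != p -> a != f p ->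
      separates (f u) (f p) a = separates u p a (+) separates p (f p) a.
    move=> au av ap afp.
    rewrite (@separates_chain _ _ u) // (@separates_chain _ u p) //.
    by rewrite [separates (f u) u a]separatesC separates_adj.
  by rewrite !C ?H2 ?nc ?(inj_eq (inv_inj fK)) ?(inv_eq fK).
have pairs : separates (f u) (f p) u = separates (f u) (f p) p.
  by apply: separates_pairC => //; rewrite eq_sym.
have adjz z : z != u -> z != f u -> f z != u -> f z != f u ->
    separates z (f z) u = separates z (f z) (f u).
  by move=> *; apply: separates_adjacent.
have out z : z != u -> z != p -> z != f u -> z != f p ->
    separates z (f z) u = separates z (f z) p.
  move=> zu zp zfu zfp.
  apply: separates_pairC; last by rewrite H2.
  - by rewrite eq_sym.
  - by rewrite eq_sym (inv_eq fK).
  - by rewrite eq_sym.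
  by rewrite eq_sym (inv_eq fK).
move=> x y.
case: (reconnectP u p fK x)
  => [->|->|-> _ _ _|-> _ _ _|xu xp xfu xfp fxu fxp fxfu fxfp].
- case: (reconnectP u p fK y) => [->|->|-> _ _ _|-> _ _ _|*];
  by rewrite ?separates_ll ?separates_rr ?H1 // H2.
- rewrite ![separates p u _]separatesC.
  case: (reconnectP u p fK y) => [->|->|-> _ _ _|-> _ _ _|*];
  by rewrite ?separates_ll ?separates_rr ?H1 // H2.
- case: (reconnectP u p fK y) => [->|->|-> _ _ _|-> _ _ _|*];
  by rewrite ?separates_ll ?separates_rr ?pairs ?other.
- rewrite ![separates (f p) (f u) _]separatesC.
  case: (reconnectP u p fK y) => [->|->|-> _ _ _|-> _ _ _|*];
  by rewrite ?separates_ll ?separates_rr ?pairs ?other.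
have := out x xu xp xfu xfp; have := adjz x xu xfu fxu fxfu.
case: (reconnectP u p fK y) => [->|->|-> _ _ _|-> _ _ _|*];
by rewrite ?nc //; congruence.
Qed.

(** * Hooks *)

Lemma ordS_neq n (i : 'I_n) : (1 < n)%N -> ordS i != i.
Proof.
move=> n1; rewrite -val_eqE /=; have := ltn_ord i.
by rewrite leq_eqVlt => /predU1P[E | lt]; [rewrite E modnn | rewrite modn_small]; lia.
Qed.

Lemma flipK n : involutive (@flip n). Proof. by case. Qed.
Lemma flip_neq n (x : point n) : flip x != x. Proof. by case: x. Qed.

Lemma mates_of_sat n (a : bipart n) f : involutive f -> (forall x, f x != x) ->
  (forall A B, sat a A B <-> forall x, pair_mem A B (f x) = pair_mem A B x) ->
  mates a f.
Proof.
move=> fK nf H; have fM := mates_of_pairing fK nf.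
suff -> : a = of_pairing fK by [].
apply: sat_inj => A B; split; first by move=> /H ?; apply/(mates_sat fM).
by move/(mates_sat fM) => ?; apply/H.
Qed.

Lemma mates_one n : mates (1 : bipart n) (@flip n).
Proof.
apply: (mates_of_sat (@flipK n) (@flip_neq n)) => A B.
split=> [/sat_graph -> [] j /=|H]; rewrite ?inE //.
by apply/sat_graph/setP=> i; rewrite inE; have := H (inr i).
Qed.

(** The pairing of the hook at [i]: the columns [i] and [i + 1], taken modulo [n],
    carry a cup on each row, and every other point is paired with its copy on
    the other row. *)
Definition hookf n (i : 'I_n) : point n -> point n :=
  reconnect (@flip n) (inr i) (inr (ordS i)).

Lemma hookfK n (i : 'I_n) : involutive (hookf i).
Proof. apply: reconnectK; [exact: flipK | exact: flip_neq]. Qed.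

Lemma hookfP n (i : 'I_n) x :
  reconnect_spec (@flip n) (inr i) (inr (ordS i)) x (hookf i x).
Proof. exact/reconnectP/flipK. Qed.

Definition hook n (i : 'I_n) : bipart n := of_pairing (hookfK i).

Lemma mates_hook n (i : 'I_n) : (1 < n)%N -> mates (hook i) (hookf i).
Proof.
move=> n1; apply: mates_of_pairing; apply: reconnect_neq.
- exact: flipK.
- exact: flip_neq.
by rewrite eq_sym; apply: contra (ordS_neq i n1) => /eqP[/eqP].
Qed.

Lemma sat_hook n (i : 'I_n) A B : (1 < n)%N -> sat (hook i) A B <->
  [/\ (ordS i \in A) = (i \in A), (ordS i \in B) = (i \in B)
    & forall j, j != i -> j != ordS i -> (j \in A) = (j \in B)].
Proof.
move=> n1; have ni := ordS_neq i n1; have M := mates_hook i n1.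
have inrE j k : (inr j == inr k :> point n) = (j == k) by [].
have inlE j k : (inl j == inl k :> point n) = (j == k) by [].
rewrite (mates_sat M); split=> [H | [HA HB H] x].
  split.
  - by have := H (inl i); rewrite /hookf /reconnect /= !inlE eqxx.
  - by have := H (inr i); rewrite /hookf /reconnect /= !inrE eqxx.
  move=> j ji jS; have := H (inr j).
  by rewrite /hookf /reconnect /= !inrE (negPf ji) (negPf jS).
case: (hookfP i x) => [->|->|->|->|] //=.
case: x => j; rewrite /= ?inlE ?inrE => ? ? ? ? *.
  by rewrite -H.
by rewrite H.
Qed.

Lemma mates_mul_hook n (a : bipart n) f i : (1 < n)%N -> mates a f ->
  mates (a * hook i) (reconnect f (inr i) (inr (ordS i))).
Proof.
move=> n1 af; have fK := mates_inv af; have nf := mates_neq af.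
have ni := ordS_neq i n1.
set u : point n := inr i; set v : point n := inr (ordS i).
have uv : u != v by rewrite eq_sym; apply: contra ni => /eqP[/eqP].
apply: mates_of_sat => [||A B].
- exact: reconnectK.
- exact: reconnect_neq.
(* off u and v, the hook forces the middle row to agree with the bottom row *)
have E (C : {set _}) z : (forall j, j != i -> j != ordS i -> (j \in C) = (j \in B)) ->
    z != u -> z != v -> pair_mem A C z = pair_mem A B z.
  by case: z => j //= H ji jv; apply: H.
split.
  case/sat_mul=> C /(mates_sat af) aC /(sat_hook _ _ _ n1)[CE BE CB] x.
  have aux w w' : w = u \/ w = v -> w' = u \/ w' = v ->
      f w != u -> f w != v -> pair_mem A B (f w) = pair_mem A C w'.
    move=> hw hw' fwu fwv; rewrite -(E C) // aC.
    by case: hw => ->; case: hw' => ->.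
  case: (reconnectP u v fK x) => [->|->|-> ? ? ?|-> ? ? ?|xu xv xfu xfv fxu fxv _ _] //=.
  - by rewrite (aux v u) ?(aux u u) //; auto.
  - by rewrite (aux v u) ?(aux u u) //; auto.
  by rewrite -!(E C) ?aC.
move=> H; apply/sat_mul.
(* On the middle row the hook only requires u and v to be treated alike; if they
   form a closed loop the common value is free, otherwise f u dictates it. *)
pose c := if f u == v then false else pair_mem A B (f u).
pose C := [set j | if (j == i) || (j == ordS i) then c else j \in B].
have CE z : pair_mem A C z = if (z == u) || (z == v) then c else pair_mem A B z.
  by case: z => j //=; rewrite inE.
exists C; last first.
  apply/(sat_hook _ _ _ n1); split.
  - by rewrite !inE !eqxx orbT.
  - by have := H u; rewrite reconnect_l.
  by move=> j /negPf ji /negPf jv; rewrite inE ji jv.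
apply/(mates_sat af) => x; rewrite !CE.
have cv : f u != v -> c = pair_mem A B (f v).
  by move=> fuv; rewrite /c (negPf fuv); have := H (f u); rewrite reconnect_fl.
case: (eqVneq x u) => [->|xu] /=.
  by rewrite (negPf (nf u)) /=; rewrite /c; case: eqP.
case: (eqVneq x v) => [->|xv] /=.
  rewrite (negPf (nf v)) orbF (inv_eq fK) [v == _]eq_sym.
  by case: (eqVneq (f u) v) => // /cv ->.
rewrite !(inv_eq fK).
case: (eqVneq x (f u)) => [xE|xfu] /=.
  by rewrite /c -xE (negPf xv).
case: (eqVneq x (f v)) => [xE|xfv] /=.
  have fuv : f u != v by apply: contra xu => /eqP fuv; rewrite xE -fuv fK.
  by rewrite cv // xE.
by have := H x; rewrite reconnect_out.
Qed.

(** * Planar matchings are products of hooks *)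

Lemma increasing_ord_id n (g : 'I_n -> 'I_n) :
  (forall j k : 'I_n, (j < k)%N -> (g j < g k)%N) -> g =1 id.
Proof.
move=> H.
have lo m : forall j : 'I_n, j = m :> nat -> (m <= g j)%N.
  elim: m => // m IH j jm; have lt : (m < n)%N by have := ltn_ord j; lia.
  by have /= := H (Ordinal lt) j; have /= := IH (Ordinal lt) erefl; lia.
have hi m : forall j : 'I_n, (n - j.+1 = m)%N -> (g j <= j)%N.
  elim: m => [|m IH] j jm; first by have := ltn_ord (g j); lia.
  have lt : (j.+1 < n)%N by lia.
  by have /= := H j (Ordinal lt); have /= := IH (Ordinal lt); lia.
move=> j; apply: val_inj => /=; have := lo _ j erefl; have := hi _ j erefl; lia.
Qed.

Lemma val_ordS n (i : 'I_n) : (i.+1 < n)%N -> ordS i = i.+1 :> nat.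
Proof. by move=> lt; rewrite /= modn_small. Qed.

Lemma position_inl n (i : 'I_n) : position (inl i) = (n + i)%N. Proof. by []. Qed.
Lemma position_inr n (i : 'I_n) : position (inr i) = (n - i.+1)%N. Proof. by []. Qed.

(** A planar matching other than the identity has a cup joining two consecutive
    points of the bottom row. *)
Lemma noncrossing_cup n (f : point n -> point n) :
  involutive f -> (forall x, f x != x) -> noncrossing f ->
  (exists2 i : 'I_n, (i.+1 < n)%N & f (inr i) = inr (ordS i)) \/ f =1 @flip n.
Proof.
move=> fK nf nc.
pose P (jk : 'I_n * 'I_n) := (jk.1 < jk.2)%N && (f (inr jk.1) == inr jk.2).
case: (pickP P) => [jk0 P0|noP].
  left; case: (arg_minnP (fun jk : 'I_n * 'I_n => jk.2 - jk.1)%N P0) => -[j k].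
  move=> /andP[/= jk /eqP fj] min; have lt : (j.+1 < n)%N by have := ltn_ord k; lia.
  exists j => //; move: (ordS j) (val_ordS lt) => w vS.
  case: (eqVneq k w) => [<-//|]; rewrite -val_eqE /= => kw.
  have := nc (inr j) (inr w); rewrite fj.
  have ltk := ltn_ord k.
  case fS : (f (inr w)) => [m|m].
    rewrite /separates /between position_inl !position_inr; lia.
  have mS : m != w :> nat by rewrite val_eqE; have := nf (inr w); rewrite fS.
  have := min (m, w); have := min (w, m); rewrite /P /= fS eqxx.
  have -> : f (inr m) == inr w by rewrite -fS fK.
  rewrite /separates /between !position_inr; have := ltn_ord m; lia.
right.
have bt j : exists k, f (inr j) == inl k.
  case E : (f (inr j)) => [k|k]; first by exists k.
  have E' : f (inr k) = inr j by rewrite -E fK.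
  have := noP (j, k); have := noP (k, j); rewrite /P /= E E' !eqxx !andbT.
  have : j != k :> nat by rewrite val_eqE; have := nf (inr j); rewrite E eq_sym.
  by move=> *; lia.
pose g j := xchoose (bt j).
have gP j : f (inr j) = inl (g j) by apply/eqP; exact: xchooseP (bt j).
have gid : g =1 id.
  apply: increasing_ord_id => j k jk.
  have := nc (inr j) (inr k); rewrite !gP /separates /between /=.
  have : g j != g k :> nat.
    rewrite val_eqE; apply/eqP => E; move: (gP j); rewrite E -gP.
    by move/(inv_inj fK) => [] jkE; rewrite jkE ltnn in jk.
  have := ltn_ord j; have := ltn_ord k; lia.
have fr j : f (inr j) = inl j by rewrite gP gid.
by case=> j /=; rewrite -?fr ?fK.
Qed.

Lemma closed_pairing_even (T : finType) (f : T -> T) (A : {set T}) :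
  involutive f -> (forall x, f x != x) -> (forall x, x \in A -> f x \in A) ->
  ~~ odd #|A|.
Proof.
move=> fK nf; elim: {A}_.+1 {-2}A (ltnSn #|A|) => // m IH A lt cl.
case: (set_0Vmem A) => [->|[x xA]]; first by rewrite cards0.
have fxA : f x \in A :\ x by rewrite !inE nf cl.
have E : #|A| = #|A :\ x :\ f x|.+2 by rewrite (cardsD1 x) xA (cardsD1 (f x)) fxA.
rewrite E /= negbK; apply: IH; first by rewrite E in lt; lia.
move=> y; rewrite !inE => /and3P[yf yx /cl ->].
by rewrite (inj_eq (inv_inj fK)) yx (inv_eq fK) yf.
Qed.

Definition column n (x : point n) : nat := match x with inl i => i | inr i => i end.

Lemma card_columns n m : (m <= n)%N ->
  #|[set x : point n | column x < m]%N| = (m + m)%N.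
Proof.
move=> mn.
have cI : #|[set i : 'I_n | i < m]%N| = m.
  rewrite -sum1_card (eq_bigl (fun i : 'I_n => i < m)%N) => [|i]; last by rewrite inE.
  by rewrite (big_ord_narrow mn) sum1_card card_ord.
have -> : [set x : point n | column x < m]%N =
    inl @: [set i : 'I_n | i < m]%N :|: inr @: [set i : 'I_n | i < m]%N.
  apply/setP=> -[i|i]; rewrite !inE.
    rewrite mem_imset ?inE; last by move=> ? ? [].
    by case: imsetP => [[]//|]; rewrite orbF.
  rewrite [in RHS]orbC mem_imset ?inE; last by move=> ? ? [].
  by case: imsetP => [[]//|]; rewrite orbF.
rewrite cardsU !card_imset ?cI; try by move=> ? ? [].
suff -> : inl @: [set i : 'I_n | i < m]%N :&: inr @: [set i : 'I_n | i < m]%N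
    = set0 :> {set point n} by rewrite cards0 subn0.
by apply/setP=> -[i|i]; rewrite !inE; apply/negP=> /andP[/imsetP[? _ ?] /imsetP[]].
Qed.

(** Beside a bottom cup at columns [i] and [i + 1], some string {p, f p} with [p]
    weakly left of column [i] and [f p] to the right of it can be rejoined with
    the cup without crossings. *)
Lemma exists_visible n (f : point n -> point n) (i : 'I_n) :
  involutive f -> (forall x, f x != x) -> noncrossing f ->
  (i.+1 < n)%N -> f (inr i) = inr (ordS i) ->
  exists p, [/\ p != inr i, p != inr (ordS i), (column p <= i)%N, (i < column (f p))%N
    & noncrossing (reconnect f (inr i) p)].
Proof.
move=> fK nf nc lt fu; have vS := val_ordS lt.
pose P x := [&& x != inr i, column x <= i & i < column (f x)]%N.
have [p0 Pp0] : exists p, P p.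
  apply/existsP; apply: contraT; rewrite negb_exists => /forallP noP.
  pose A := [set x : point n | column x < i.+1]%N.
  (* otherwise the left part without [inr i] is closed under f, although its
     cardinality is odd *)
  have iA : inr i \in A by rewrite inE /=.
  have := @closed_pairing_even _ f (A :\ inr i) fK nf.
  have -> : odd #|A :\ inr i|.
    have := cardsD1 (inr i) A; rewrite iA card_columns; last by lia.
    by lia.
  apply=> x; rewrite !inE => /andP[xu xA]; rewrite (inv_eq fK) fu.
  have := noP x; rewrite /P xu; move: (xA); rewrite ltnS => -> /=.
  rewrite -leqNgt [(column (f x) < _)%N]ltnS => ->.
  by rewrite andbT; apply: contraTneq xA => ->; rewrite /column vS; lia.
(* among the crossing strings, the nearest to the cup, whose left end has least
   position *)
have [p /and3P[pu cp cfp] min] := arg_minnP (@position n) Pp0.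
have pv : p != inr (ordS i).
  by apply: contraTneq cp => ->; rewrite /column vS; lia.
exists p; split=> //.
(* the points weakly left of column i occupy an interval of positions *)
have pp (x : point n) : (column x <= i)%N = (n - i.+1 <= position x <= n + i)%N.
  by case: x => k; rewrite /column ?position_inl ?position_inr; have := ltn_ord k; lia.
have pu' : position p != position (inr i : point n) by rewrite eq_position.
move: cp cfp; rewrite ltnNge !pp => cp cfp.
have posu : position (inr i : point n) = (n - i.+1)%N by [].
have posv : position (inr (ordS i) : point n) = (n - i.+2)%N by rewrite -vS.
apply: noncrossing_split => //.
- by rewrite fu posu posv; lia.
- by rewrite fu.
- by rewrite fu /separates posv posu /between; lia.
move=> z; rewrite fu -!eq_position => zu zv zp zfp.
have := nc p z.
have := min z; have := min (f z); rewrite /P fK !ltnNge !pp -!eq_position posu.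
have fzu : position (f z) != (n - i.+1)%N.
  by rewrite -posu eq_position (inv_eq fK) fu -eq_position.
have : position (f z) != position p by rewrite eq_position (inv_eq fK) -eq_position.
have : position (f z) != position (f p).
  by rewrite eq_position (inj_eq (inv_inj fK)) -eq_position.
move: zu zv fzu; rewrite posu posv /separates /between posu; lia.
Qed.

(** The total horizontal distance covered by the strings, each counted from both
    of its ends. The truncated subtractions add up to the absolute difference. *)
Definition spread n (f : point n -> point n) : nat :=
  (\sum_(x : point n) ((column x - column (f x)) + (column (f x) - column x)))%N.

Lemma ltn_sum_support (T : finType) (F G : T -> nat) (s : seq T) :
  uniq s -> (forall x, x \notin s -> F x = G x) ->
  (\sum_(x <- s) F x < \sum_(x <- s) G x)%N -> (\sum_x F x < \sum_x G x)%N.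
Proof.
move=> us out lt.
rewrite (bigID (mem s)) [ltnRHS](bigID (mem s)) /= -!big_uniq //=.
by rewrite [X in (_ + X < _)%N](eq_bigr G) ?ltn_add2r // => x; apply: out.
Qed.

Lemma spread_split n (f : point n -> point n) (i : 'I_n) p :
  involutive f -> (forall x, f x != x) ->
  (i.+1 < n)%N -> f (inr i) = inr (ordS i) ->
  p != inr i -> p != inr (ordS i) -> (column p <= i)%N -> (i < column (f p))%N ->
  (spread (reconnect f (inr i) p) < spread f)%N.
Proof.
move=> fK nf lt fu pu pv cp cfp; have vS := val_ordS lt.
set u : point n := inr i; pose v : point n := inr (ordS i).
have up : u != p by rewrite eq_sym.
have uv : u != v by rewrite /v -fu eq_sym nf.
have vp : v != p by rewrite eq_sym.
have fpu : f p != u by rewrite (inv_eq fK) fu.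
have fpv : f p != v by rewrite (inv_eq fK) /v -fu fK.
apply: (@ltn_sum_support _ _ _ [:: u; v; p; f p]).
- by rewrite /= !inE !negb_or uv up vp ![_ == f p]eq_sym fpu fpv nf.
- move=> x; rewrite !inE !negb_or => /and4P[xu xv xp xfp].
  by rewrite reconnect_out // fu.
have fuE : f u = v by [].
have fvE : f v = u by rewrite -fuE fK.
have ru : reconnect f u p u = p by rewrite reconnect_l.
have rp : reconnect f u p p = u by rewrite reconnect_r.
have rv : reconnect f u p v = f p by rewrite -fuE reconnect_fl // fuE.
have rq : reconnect f u p (f p) = v by rewrite -fuE reconnect_fr // fuE.
rewrite !big_cons !big_nil /= ru rp rv rq fuE fvE fK.
have cu : column u = i by [].
have cv : column v = i.+1 by rewrite -vS.
by rewrite cu cv; move: cp cfp; lia.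
Qed.

Lemma planar_ind n (T : {set bipart n}) : (1 < n)%N ->
  1 \in T -> (forall a i, a \in T -> a * hook i \in T) ->
  forall a f, mates a f -> noncrossing f -> a \in T.
Proof.
move=> n1 T1 Th a f; elim: {f}_.+1 {-2}f (ltnSn (spread f)) a => // m IH f lt a af nc.
have fK := mates_inv af; have nf := mates_neq af.
case: (noncrossing_cup fK nf nc) => [[i ilt fi]|ff]; last first.
  by rewrite (mates_unique af (mates_one n)).
have [p [pu pv cp cfp nc']] := exists_visible fK nf nc ilt fi.
have up : inr i != p by rewrite eq_sym.
have gK := @reconnectK _ f (inr i) p fK nf.
have ng := reconnect_neq fK nf up.
have bM := mates_of_pairing gK ng.
have -> : a = of_pairing gK * hook i.
  apply: (mates_unique af (mates_mul_hook i n1 bM)) => x.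
  by rewrite -fi reconnect_undo // fi.
apply: Th; apply: IH bM nc'.
by rewrite ltnS in lt; apply: leq_trans lt; apply: spread_split.
Qed.

(** * Powers of the rotation *)

Lemma graph_inj n (f g : 'I_n -> 'I_n) f_inj g_inj :
  @graph n f f_inj = @graph n g g_inj -> f =1 g.
Proof.
move=> E i; have : sat (graph f_inj) (f @^-1: [set f i]) [set f i] by apply/sat_graph.
by rewrite E => /sat_graph/setP/(_ i); rewrite !inE eqxx => /esym/eqP.
Qed.

Lemma eq_graph n (f g : 'I_n -> 'I_n) f_inj g_inj :
  f =1 g -> @graph n f f_inj = @graph n g g_inj.
Proof.
by move=> fg; apply: sat_inj => A B; split=> /sat_graph ->; apply/sat_graph/setP=> i;
  rewrite !inE fg.
Qed.

(** Translation by [k] modulo [n]. *)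
Definition shift n k (i : 'I_n) : 'I_n := iter k (@ordS n) i.

Lemma shift_inj n k : injective (@shift n k).
Proof. by elim: k => // k IH i j /= /ordS_inj /IH. Qed.

Lemma val_shift n k (i : 'I_n) : shift k i = (i + k) %% n :> nat.
Proof.
elim: k => [|k IH] /=; first by rewrite addn0 modn_small.
by rewrite IH -addn1 modnDml addn1 addnS.
Qed.

Lemma shiftD n j k (i : 'I_n) : shift j (shift k i) = shift (j + k) i.
Proof. by rewrite /shift iterD. Qed.

Lemma shift_mod n j k (i : 'I_n) : j = k %[mod n] -> shift j i = shift k i.
Proof. by move=> E; apply: val_inj; rewrite /= !val_shift -modnDmr E modnDmr. Qed.

Lemma rhoX n k : rho n ^+ k = graph (@shift_inj n k).
Proof.
elim: k => [|k IH]; first exact: eq_graph.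
by rewrite expgSr IH graphM; apply: eq_graph.
Qed.

Lemma rhoX_mod n j k : j = k %[mod n] -> rho n ^+ j = rho n ^+ k.
Proof. by move=> E; rewrite !rhoX; apply: eq_graph => i; apply: shift_mod. Qed.

Lemma rhoX_eq n j k : (0 < n)%N -> rho n ^+ j = rho n ^+ k -> j = k %[mod n].
Proof.
move=> n0; rewrite !rhoX => /graph_inj/(_ (Ordinal n0))/(congr1 val).
by rewrite /= !val_shift.
Qed.

Lemma rho_expn n : rho n ^+ n = 1.
Proof. by rewrite (@rhoX_mod _ _ 0) ?expg0 // modnn mod0n. Qed.

Lemma rhoV_exp n : (rho n)^-1 = rho n ^+ n.-1.
Proof.
case: n => [|n]; first by apply: bip_eq => -[[]|[]].
rewrite -[LHS]mulg1 -(rho_expn n.+1) expgS.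
by rewrite mulgA Vrho mul1g.
Qed.

Lemma bip_expE n k : exists m, bip_exp (rho n) k = rho n ^+ m.
Proof.
case: k => m; first by exists m.
by exists (n.-1 * m.+1)%N; rewrite /= expgnA -rhoV_exp expVgn.
Qed.

(** Renaming of the unprimed points by [s] and of the primed points by [t]. *)
Definition relabel n (s t : 'I_n -> 'I_n) (x : point n) : point n :=
  match x with inl i => inl (s i) | inr i => inr (t i) end.

Lemma mates_graph n (a : bipart n) f (s s' t t' : 'I_n -> 'I_n)
    (s_inj : injective s) (t_inj : injective t) :
  cancel s s' -> cancel s' s -> cancel t t' -> cancel t' t -> mates a f ->
  mates (graph s_inj * a * graph t_inj) (relabel s' t \o f \o relabel s t').
Proof.
move=> sK s'K tK t'K af; have fK := mates_inv af; have nf := mates_neq af.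
have rK : cancel (relabel s t') (relabel s' t) by case=> i /=; rewrite ?sK ?t'K.
have r'K : cancel (relabel s' t) (relabel s t') by case=> i /=; rewrite ?s'K ?tK.
apply: mates_of_sat => [x|x|A B] /=; first by rewrite r'K fK rK.
  by rewrite (can2_eq r'K rK).
pose C := s' @^-1: A; pose D := t @^-1: B.
have E x : pair_mem A B (relabel s' t x) = pair_mem C D x.
  by case: x => i /=; rewrite inE.
split.
  case/sat_mul=> D' /sat_mul[C' /sat_graph AE /(mates_sat af) H] /sat_graph DE x.
  have CE : C = C' by apply/setP=> i; rewrite /C AE !inE s'K.
  have {}DE : D = D' by rewrite DE.
  by rewrite E CE DE H -CE -DE -E rK.
move=> H; apply/sat_mul; exists D; last exact/sat_graph.
apply/sat_mul; exists C; first by apply/sat_graph/setP=> i; rewrite !inE sK.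
by apply/(mates_sat af) => x; have := H (relabel s' t x); rewrite r'K !E.
Qed.

(** As [k * n.-1] is opposite to [k] modulo [n], it serves as a natural number
    exponent for the inverse of [rho n ^+ k]. *)
Lemma shiftK n k : cancel (@shift n k) (shift (k * n.-1)).
Proof.
move=> i; rewrite shiftD -{2}[i]/(shift 0 i); apply: shift_mod.
by rewrite addnC -mulnS prednK ?modnMl ?mod0n //; case: i => i /=; case: (n).
Qed.

Lemma shiftVK n k : cancel (@shift n (k * n.-1)) (shift k).
Proof. by move=> i; rewrite shiftD addnC -shiftD shiftK. Qed.

Lemma mates_rho n (a : bipart n) f c d : mates a f ->
  mates (rho n ^+ c * a * rho n ^+ (d * n.-1))
    (relabel (shift (c * n.-1)) (shift (d * n.-1)) \o f \o relabel (shift c) (shift d)).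
Proof.
move=> af; rewrite !rhoX.
exact: mates_graph (@shiftK n c) (@shiftVK n c) (@shiftVK n d) (@shiftK n d) af.
Qed.

Lemma rhoXV n k : rho n ^+ k * rho n ^+ (k * n.-1) = 1.
Proof. by rewrite -expgnDr rhoX; apply: eq_graph => i; rewrite addnC -shiftD shiftK. Qed.

Lemma rhoVX n k : rho n ^+ (k * n.-1) * rho n ^+ k = 1.
Proof. by rewrite -expgnDr addnC expgnDr rhoXV. Qed.

Lemma rho_conjK n (a : bipart n) k l :
  rho n ^+ (k * n.-1) * (rho n ^+ k * a * rho n ^+ l) * rho n ^+ (l * n.-1) = a.
Proof. by rewrite !mulgA rhoVX mul1g -mulgA rhoXV mulg1. Qed.

Lemma matching_rho n (a : bipart n) k l :
  matching a -> matching (rho n ^+ k * a * rho n ^+ l).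
Proof.
case/matesP=> f af.
have := mates_matching (mates_graph (@shift_inj n k) (@shift_inj n l)
  (@shiftK n k) (@shiftVK n k) (@shiftK n l) (@shiftVK n l) af).
by rewrite !rhoX; apply.
Qed.

(** * Annular matchings are closed under products *)

Lemma AJ_P n (a : bipart n) : a \in AJ n <->
  exists b f k l, [/\ mates b f, noncrossing f & a = rho n ^+ k * b * rho n ^+ l].
Proof.
rewrite inE; split.
  case/andP=> /asboolP[b [k [l [pb]]]].
  have [k' ->] := bip_expE n k; have [l' ->] := bip_expE n l => aE am.
  have /matesP[f bf] : matching b.
    by rewrite -(rho_conjK b k' l') -aE; apply: matching_rho.
  exists b, f, k', l'; split=> //; exact/(planar_mates bf).
case=> b [f [k [l [bf nc ->]]]]; apply/andP; split.
  apply/asboolP; exists b, (Posz k), (Posz l); split=> //.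
  exact/(planar_mates bf).
exact/matching_rho/(mates_matching bf).
Qed.

(** The first [c] unprimed and the first [d] primed points. They occupy an interval
    of positions around the middle. *)
Definition inner n c d (x : point n) : bool :=
  match x with inl i => i < c | inr j => j < d end%N.

(** A region [inner c d] that is a union of blocks can be moved as a whole to the
    outside of the remaining points, by rotating the two rows. *)
Lemma noncrossing_rotate n (f g : point n -> point n) c d :
  (c <= n)%N -> (d <= n)%N -> noncrossing f ->
  (forall x, inner c d (f x) = inner c d x) ->
  (forall x, relabel (shift c) (shift d) (g x) = f (relabel (shift c) (shift d) x)) ->
  noncrossing g.
Proof.
move=> cn dn nc cl; set r := relabel _ _ => gr.
have sh k (i : 'I_n) : (k <= n)%N -> (shift k i < k)%N = (n <= i + k)%N /\
    (if (n <= i + k)%N then shift k i + n = i + k else shift k i = i + k :> nat)%N.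
  move=> kn; rewrite val_shift; have lti := ltn_ord i.
  case: (leqP n (i + k)) => h; last by rewrite modn_small; lia.
  by rewrite -{1 2}(subnK h) modnDr modn_small; lia.
(* The new position of z against the old position of its image under r: inner
   points move to the two ends, the others move inwards. *)
have pos (z : point n) : if inner c d (r z)
    then (position (r z) < n /\ position z + n = position (r z) + d /\
          position z < d)%N \/
         (n <= position (r z) /\ position z + c = position (r z) + n /\
          2 * n <= position z + c)%N
    else ((position (r z) < n /\ position z < n /\ position z = position (r z) + d) \/
         (n <= position (r z) /\ n <= position z /\ position z + c = position (r z))) /\
         (d <= position z /\ position z + c < 2 * n)%N.
  case: z => i; rewrite /r /= -/(position _); have lti := ltn_ord i.
    have ltj := ltn_ord (shift c i).
    by case: (sh c i cn) => ->; case: (leqP n (i + c)) => h; lia.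
  have ltj := ltn_ord (shift d i).
  by case: (sh d i dn) => ->; case: (leqP n (i + d)) => h; lia.
have reg z : if inner c d (r z) then (position z < d)%N || (2 * n <= position z + c)%N
    else (d <= position z)%N && (position z + c < 2 * n)%N.
  by move: (pos z); case: (inner c d (r z)); lia.
(* the order is preserved inside the region and outside of it *)
have mono y z : inner c d (r y) = inner c d (r z) ->
    (position y < position z)%N = (position (r y) < position (r z))%N.
  by move=> E; move: (pos y) (pos z); rewrite E; case: (inner c d (r z)); lia.
have ing z : inner c d (r (g z)) = inner c d (r z) by rewrite gr cl.
move=> x y; case: (eqVneq (inner c d (r x)) (inner c d (r y))) => [E|ne].
  have := nc (r x) (r y); rewrite -!gr /separates /between.
  have M a b : inner c d (r a) = inner c d (r x) -> inner c d (r b) = inner c d (r x) ->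
      (position a < position b)%N = (position (r a) < position (r b))%N.
    by move=> ea eb; apply: mono; rewrite ea eb.
  rewrite (M x y) ?(M y (g x)) ?(M (g x) y) ?(M y x) ?ing //.
  by rewrite (M x (g y)) ?(M (g y) (g x)) ?(M (g x) (g y)) ?(M (g y) x) ?ing.
clear mono pos sh; move: ne (reg x) (reg (g x)) (reg y) (reg (g y)).
rewrite !ing /separates /between.
move: (position x) (position (g x)) (position y) (position (g y)) => p q s t.
by case: (inner c d (r x)); case: (inner c d (r y)) => // _; lia.
Qed.

Lemma hook_rho n (i : 'I_n) : (1 < n)%N -> hook i * rho n = rho n * hook (ordS i).
Proof.
move=> n1; have SE (j k : 'I_n) : (ordS j == ordS k) = (j == k).
  by rewrite (inj_eq (@ordS_inj n)).
apply: sat_inj => A B; split.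
  case/sat_mul=> C /(sat_hook _ _ _ n1)[hA hC H] /sat_graph CE; subst C.
  apply/sat_mul; exists ((@ord_pred n) @^-1: A).
    by apply/sat_graph/setP=> j; rewrite !inE ordSK.
  apply/(sat_hook _ _ _ n1); rewrite !inE !ordSK; split=> //.
    by move: hC; rewrite !inE.
  move=> j; rewrite -[j]ord_predK !SE => ji jS.
  by rewrite inE ordSK H // inE.
case/sat_mul=> C /sat_graph AE /(sat_hook _ _ _ n1)[hC hB H].
apply/sat_mul; exists ((@ordS n) @^-1: B); last exact/sat_graph.
apply/(sat_hook _ _ _ n1); rewrite AE !inE; split=> // j ji jS.
by rewrite !inE H // SE.
Qed.

Lemma hook_rhoX n (i : 'I_n) k : (1 < n)%N ->
  hook i * rho n ^+ k = rho n ^+ k * hook (shift k i).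
Proof.
move=> n1; elim: k => [|k IH]; first by rewrite expg0 mulg1 mul1g.
by rewrite expgSr mulgA IH -mulgA hook_rho // mulgA.
Qed.

Lemma mul_rhoX_hook n (a : bipart n) k l (i : 'I_n) : (1 < n)%N ->
  rho n ^+ k * a * rho n ^+ l * hook i
  = rho n ^+ k * (a * hook (shift (l * n.-1) i)) * rho n ^+ l.
Proof.
move=> n1; have := hook_rhoX (shift (l * n.-1) i) l n1; rewrite shiftVK.
move: (rho n ^+ k) (rho n ^+ l) (hook _) (hook _) => r s g h E.
by rewrite -!mulgA E.
Qed.

Lemma AJ_rho n (a : bipart n) k l : a \in AJ n -> rho n ^+ k * a * rho n ^+ l \in AJ n.
Proof.
move/AJ_P=> [b [f [k' [l' [bf nc ->]]]]]; apply/AJ_P.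
exists b, f, (k + k')%N, (l' + l)%N; split=> //.
by rewrite !expgnDr !mulgA.
Qed.

Lemma AJ_planar n (a : bipart n) f : mates a f -> noncrossing f -> a \in AJ n.
Proof.
by move=> af nc; apply/AJ_P; exists a, f, 0%N, 0%N; rewrite mul1g mulg1.
Qed.

Lemma AJ_planar_hook n (a : bipart n) f (i : 'I_n) : (i.+1 < n)%N ->
  mates a f -> noncrossing f -> a * hook i \in AJ n.
Proof.
move=> lt af nc; have n1 : (1 < n)%N by lia.
apply: AJ_planar (mates_mul_hook i n1 af) _.
apply: noncrossing_reconnect (mates_inv af) (mates_neq af) nc _.
by rewrite !position_inr val_ordS //; lia.
Qed.

Lemma rho_conj_mixK n (a : bipart n) k l :
  rho n ^+ (k * n.-1) * (rho n ^+ k * a * rho n ^+ (l * n.-1)) * rho n ^+ l = a.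
Proof. by rewrite !mulgA rhoVX mul1g -mulgA rhoVX mulg1. Qed.

(** The hook at the last column joins n' and 1', the two ends of the bottom row.
    Unless n' and 1' form a block, let [f u] be the partner of u = 1': the points
    from [u] to [f u] form a region [inner c d] with [0 < d < n]. After moving it
    to the outside the hook joins consecutive points. *)
Lemma AJ_planar_last_hook n (a : bipart n) f (i : 'I_n) : (1 < n)%N ->
  i.+1 = n -> mates a f -> noncrossing f -> a * hook i \in AJ n.
Proof.
move=> n1 iE af nc; have fK := mates_inv af; have nf := mates_neq af.
have i0 : ordS i = 0%N :> nat by rewrite /= iE modnn.
set u : point n := inr (ordS i).
have pu : position u = n.-1 by rewrite position_inr i0; lia.
case: (eqVneq (f u) (inr i)) => [fu|fu].
  have -> : a * hook i = a; last exact: AJ_planar nc.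
  apply: (mates_unique (mates_mul_hook i n1 af)) af _ => x.
  by rewrite reconnect_id // -fu fK.
pose c := if f u is inl p then p.+1 else 0%N.
pose d := if f u is inr q then q.+1 else 1%N.
have cn : (c <= n)%N by rewrite /c; case: (f u) => // p; apply: ltn_ord.
have d0 : (0 < d)%N by rewrite /d; case: (f u).
have dn : (d < n)%N.
  rewrite /d; case E: (f u) => [p|q] //.
  have : q != i :> nat by rewrite val_eqE; move: fu; rewrite E.
  by have := ltn_ord q; lia.
have innerE x : inner c d x = [|| x == u, x == f u | separates u (f u) x].
  rewrite -!eq_position /separates /between pu /c /d.
  have := nf u; rewrite -eq_position pu.
  case: (f u) => q; case: x => j; rewrite /inner ?position_inl ?position_inr;
    have := ltn_ord j; have := ltn_ord q; clear -n1; lia.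
have cl x : inner c d (f x) = inner c d x.
  rewrite !innerE nc (inv_eq fK) (inj_eq (inv_inj fK)).
  by rewrite !orbA [(x == _) || _]orbC.
have bf := mates_rho c d af.
have ncb : noncrossing (relabel (shift (c * n.-1)) (shift (d * n.-1)) \o f
    \o relabel (shift c) (shift d)).
  apply: noncrossing_rotate cn (ltnW dn) nc cl _ => x /=.
  by case: (f _) => j /=; rewrite shiftVK.
have ltj : (n.-1 - d < n)%N by lia.
pose j := Ordinal ltj.
have ij' : shift (d * n.-1) i = j.
  rewrite -(shiftK d j); congr shift.
  by apply: val_inj; rewrite /= val_shift /= subnK ?modn_small; lia.
rewrite -(rho_conj_mixK a c d) mul_rhoX_hook // ij'.
by apply: AJ_rho; apply: AJ_planar_hook bf ncb; rewrite /=; lia.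
Qed.

Lemma AJ_hook n (a : bipart n) i : (1 < n)%N -> a \in AJ n -> a * hook i \in AJ n.
Proof.
move=> n1 /AJ_P[b [f [k [l [bf nc ->]]]]].
rewrite mul_rhoX_hook //; set j := shift _ i.
apply: AJ_rho; case: (ltnP j.+1 n) => [lt|ge]; first exact: AJ_planar_hook bf nc.
by apply: AJ_planar_last_hook bf nc => //; have := ltn_ord j; lia.
Qed.

Lemma AJ1 n : 1 \in AJ n.
Proof.
apply: AJ_planar (mates_one n) _ => x y.
rewrite /separates /between; case: x => i; case: y => j;
  rewrite /flip ?position_inl ?position_inr; have := ltn_ord i; have := ltn_ord j; lia.
Qed.

Lemma AJ_rho1 n k : rho n ^+ k \in AJ n.
Proof. by have := AJ_rho k 0 (AJ1 n); rewrite !mulg1. Qed.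

(** The monoid of annular matchings is generated by [rho n] and any one hook. *)
Lemma AJ_ind n (i0 : 'I_n) (T : {set bipart n}) : (1 < n)%N ->
  {in T &, forall a b, a * b \in T} -> rho n \in T -> hook i0 \in T -> AJ n \subset T.
Proof.
move=> n1 TM Tr Th.
have TS k : rho n ^+ k.+1 \in T.
  by elim: k => // k IH; rewrite expgS; apply: TM.
have T1 : 1 \in T by have := TS n.-1; rewrite prednK ?rho_expn // ltnW.
have TX k : rho n ^+ k \in T by case: k.
have Thk j : hook j \in T.
  have [k ->] : exists k, j = shift k i0.
    exists (j + (n - i0))%N; apply: val_inj; rewrite /= val_shift addnCA subnKC 1?ltnW //.
    by rewrite modnDr modn_small.
  have -> : hook (shift k i0) = rho n ^+ (k * n.-1) * hook i0 * rho n ^+ k.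
    by rewrite -mulgA hook_rhoX // mulgA rhoVX mul1g.
  by do 2!apply: (TM) => //.
apply/subsetP=> a /AJ_P[b [f [k [l [bf nc ->]]]]].
apply: (TM) => //; apply: (TM) => //.
by apply: planar_ind bf nc => // c j cT; apply: (TM).
Qed.

Lemma AJ_mul n (a b : bipart n) : (1 < n)%N -> a \in AJ n -> b \in AJ n -> a * b \in AJ n.
Proof.
move=> n1 aA bA; pose i0 := Ordinal (ltnW n1).
(* the right multipliers of S in S form a subsemigroup containing rho and a hook *)
pose T := [set b in AJ n | [forall a in AJ n, a * b \in AJ n]].
have TE c : (c \in T) = (c \in AJ n) && [forall a in AJ n, a * c \in AJ n].
  by rewrite inE.
suff /subsetP/(_ b bA) : AJ n \subset T.
  by rewrite TE => /andP[_ /forall_inP/(_ a aA)].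
have TP c : c \in AJ n -> (forall a, a \in AJ n -> a * c \in AJ n) -> c \in T.
  by move=> cA H; rewrite TE cA; apply/forall_inP.
apply: (@AJ_ind _ i0) => //.
- move=> c d; rewrite !TE => /andP[cA /forall_inP H] /andP[dA /forall_inP H'].
  by rewrite H' //=; apply/forall_inP=> e eA; rewrite mulgA H' ?H.
- apply: TP => [|c cA]; first exact: (AJ_rho1 n 1).
  by have := AJ_rho 0 1 cA; rewrite mul1g.
apply: TP => [|c cA]; last exact: AJ_hook.
by rewrite -[hook i0]mul1g; apply: AJ_hook => //; apply: AJ1.
Qed.

Lemma hookV n (i : 'I_n) : (1 < n)%N -> (hook i)^-1 = hook i.
Proof.
move=> n1; apply: sat_inj => A B; split.
  case/sat_star/(sat_hook _ _ _ n1)=> hA hB H.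
  by apply/(sat_hook _ _ _ n1); split=> // *; rewrite H.
case/(sat_hook _ _ _ n1)=> hA hB H.
by apply/sat_star/(sat_hook _ _ _ n1); split=> // *; rewrite H.
Qed.

Lemma AJ_inv n (a : bipart n) : (1 < n)%N -> a \in AJ n -> a^-1 \in AJ n.
Proof.
move=> n1 aA; pose i0 := Ordinal (ltnW n1).
have A0 : hook i0 \in AJ n by rewrite -[hook i0]mul1g; apply: AJ_hook => //; apply: AJ1.
pose T := [set b : bipart n | b^-1 \in AJ n].
have TE b : (b \in T) = (b^-1 \in AJ n) by rewrite inE.
suff /subsetP/(_ a aA) : AJ n \subset T by rewrite TE.
apply: (@AJ_ind _ i0) => // [b c||]; rewrite !TE.
- by move=> bA cA; rewrite invgM AJ_mul.
- by rewrite rhoV_exp AJ_rho1.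
by rewrite hookV.
Qed.

(** * Rank *)

Definition is_primed n (x : point n) : bool := if x is inr _ then true else false.

(** The columns whose unprimed point lies in a transverse block. *)
Definition through n (f : point n -> point n) : {set 'I_n} :=
  [set i | is_primed (f (inl i))].

Lemma rank_mates n (a : bipart n) f : mates a f -> bip_rank a = #|through f|.
Proof.
move=> af; rewrite /bip_rank.
rewrite -(@card_in_imset _ _ (fun i => [set y | same a (inl i) y])).
  apply: eq_card => B; rewrite !inE; apply/andP/imsetP.
    case=> /mem_blocks[x ->] /andP[/existsP[i]].
    rewrite inE => xi /existsP[j]; rewrite inE => xj.
    have ix : same a (inl i) x by rewrite same_sym.
    exists i; first by rewrite inE (mates_pair af (same_trans ix xj)).
    by apply/setP=> y; rewrite !inE; apply/idP/idP; apply: same_trans.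
  case=> i; rewrite inE => iT ->; split; first by apply/mem_blocks; exists (inl i).
  apply/andP; split; first by apply/existsP; exists i; rewrite inE samexx.
  case E: (f (inl i)) iT => [//|j] _; apply/existsP; exists j.
  by rewrite inE -E (mates_samef af).
move=> i j; rewrite !inE => iT _ /setP/(_ (inl j)); rewrite !inE samexx.
rewrite (mates_same af) => /orP[/eqP[->//]|/eqP E].
by rewrite -E in iT.
Qed.

Lemma same_inv n (a : bipart n) x y : same a^-1 x y = same a (flip x) (flip y).
Proof. exact: same_of_equiv. Qed.

Lemma mates_invg n (a : bipart n) f : mates a f ->
  mates a^-1 (@flip n \o f \o @flip n).
Proof.
move=> af; split=> [x|x y] /=.
  by rewrite (inv_eq (@flipK n)) (mates_neq af).
by rewrite same_inv (mates_same af) (inj_eq (inv_inj (@flipK n))) (inv_eq (@flipK n)).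
Qed.

Lemma rank_inv n (a : bipart n) : matching a -> bip_rank a^-1 = bip_rank a.
Proof.
case/matesP=> f af; rewrite (rank_mates af) (rank_mates (mates_invg af)).
have fK := mates_inv af.
set T := through _; set T' := through f.
have <- : #|(inr @: T : {set point n})| = #|T| by apply: card_imset => ? ? [].
have <- : #|(inl @: T' : {set point n})| = #|T'| by apply: card_imset => ? ? [].
rewrite -(card_imset (inl @: T' : {set point n}) (inv_inj fK)).
apply: eq_card => x; apply/imsetP/imsetP.
  case=> j; rewrite inE /= => jT ->.
  case E: (f (inr j)) jT => [i|//] _; exists (inl i); last by rewrite -E fK.
  by apply: imset_f; rewrite inE -E fK.
case=> _ /imsetP[i + ->] ->; rewrite inE.
case E: (f (inl i)) => [//|j] _; exists j => //.
by rewrite inE /= -E fK.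
Qed.

Lemma through_sub n (a b : bipart n) f g : mates a f -> mates b g ->
  (forall i k, same a (inl i) (inl k) -> same b (inl i) (inl k)) ->
  through g \subset through f.
Proof.
move=> af bg H; apply/subsetP=> i; rewrite !inE.
case E: (f (inl i)) => [k|//].
have ik : inl i != inl k :> point n by rewrite -E eq_sym (mates_neq af).
by rewrite (mates_pair bg (H i k _)) // -E (mates_samef af).
Qed.

Lemma same_mulr n (a b : bipart n) i k :
  same a (inl i) (inl k) -> same (a * b) (inl i) (inl k).
Proof.
by move/same_sat=> H; apply/same_sat=> A B /sat_mul[C aC _]; apply: (H A C).
Qed.

Lemma same_mulV n (a : bipart n) i k :
  same a (inl i) (inr k) -> same (a * a^-1) (inl i) (inr i).
Proof.
move/same_sat=> H; apply/same_sat=> A B /sat_mul[C aC /sat_star bC] /=.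
by have /= -> := H _ _ aC; have /= -> := H _ _ bC.
Qed.

(** The partition monoid is a regular *-monoid. *)
Lemma mul_invgK n (a : bipart n) : a * a^-1 * a = a.
Proof.
apply: sat_inj => A B; split=> [|aAB].
  case/sat_mul=> C /sat_mul[D aAD /sat_star aCD] aCB x y s.
  case: x y s => i [] j s /=.
  - exact: (aAD _ _ s).
  - by have /= -> := aAD _ _ s; have /= <- := aCD _ _ s; have /= -> := aCB _ _ s.
  - by have /= <- := aAD _ _ s; have /= -> := aCD _ _ s; have /= <- := aCB _ _ s.
  - exact: (aCB _ _ s).
apply/sat_mul; exists A => //; apply/sat_mul; exists B => //; exact/sat_star.
Qed.

Lemma AJ_matching n (a : bipart n) : a \in AJ n -> matching a.
Proof. by rewrite inE => /andP[]. Qed.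

Lemma rank_le n (a : bipart n) : matching a -> (bip_rank a <= n)%N.
Proof.
by case/matesP=> f /rank_mates ->; rewrite -[leqRHS]card_ord max_card.
Qed.

Lemma rank_one n : bip_rank (1 : bipart n) = n.
Proof.
rewrite (rank_mates (mates_one n)) -[RHS]card_ord -cardsT.
by apply: eq_card => i; rewrite !inE.
Qed.

Section Structure.
Variables (n : nat) (n1 : (1 < n)%N).
Implicit Types a b x : bipart n.

Lemma rank_mulr a b : a \in AJ n -> b \in AJ n -> (bip_rank (a * b)%g <= bip_rank a)%N.
Proof.
move=> aA bA; have /matesP[f af] := AJ_matching aA.
have /matesP[g abg] := AJ_matching (AJ_mul n1 aA bA).
rewrite (rank_mates af) (rank_mates abg); apply/subset_leq_card/(through_sub af abg).
by move=> i k; apply: same_mulr.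
Qed.

Lemma rank_mull a b : a \in AJ n -> b \in AJ n -> (bip_rank (a * b)%g <= bip_rank b)%N.
Proof.
move=> aA bA; rewrite -rank_inv ?AJ_matching ?AJ_mul // invgM.
by rewrite (leq_trans (rank_mulr _ _)) ?AJ_inv // rank_inv ?AJ_matching.
Qed.

Lemma rank_rho k : bip_rank (rho n ^+ k) = n.
Proof.
apply/eqP; rewrite eqn_leq rank_le ?AJ_matching ?AJ_rho1 //=.
by rewrite -{1}(rank_one n) -(rhoXV n k) rank_mulr ?AJ_rho1.
Qed.

Lemma rank_rhol k a : a \in AJ n -> bip_rank (rho n ^+ k * a) = bip_rank a.
Proof.
move=> aA; have R := AJ_rho1 n; apply/eqP; rewrite eqn_leq rank_mull //=.
rewrite -{1}[a](mul1g) -(rhoVX n k) -mulgA rank_mull // AJ_mul //.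
Qed.

Lemma rank_rhor k a : a \in AJ n -> bip_rank (a * rho n ^+ k) = bip_rank a.
Proof.
move=> aA; have R := AJ_rho1 n; apply/eqP; rewrite eqn_leq rank_mulr //=.
rewrite -{1}[a](mulg1) -(rhoXV n k) mulgA rank_mulr // AJ_mul //.
Qed.

(** The hook at the first two columns. *)
Definition hook0 : bipart n := hook (Ordinal (ltnW n1)).
Local Notation i0 := (Ordinal (ltnW n1)).

Lemma AJ_hook0 : hook0 \in AJ n.
Proof. by rewrite -[hook0]mul1g AJ_hook ?AJ1. Qed.

Lemma through_hook : through (hookf i0) = [set: 'I_n] :\ i0 :\ ordS i0.
Proof.
apply/setP=> j; rewrite !inE andbT.
have inlE (k l : 'I_n) : (inl k == inl l :> point n) = (k == l) by [].
rewrite /hookf /reconnect /= !inlE.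
by case: (eqVneq j i0) => [->|_] /=; rewrite ?andbF //; case: eqVneq.
Qed.

Lemma rank_hook0 : bip_rank hook0 = (n - 2)%N.
Proof.
rewrite (rank_mates (mates_hook _ n1)) through_hook.
have := cardsD1 i0 [set: 'I_n]; have := cardsD1 (ordS i0) ([set: 'I_n] :\ i0).
rewrite cardsT card_ord !inE ordS_neq //= => ->.
by move=> E; rewrite [X in (X - _)%N]E !add1n subn2.
Qed.

Lemma hook0_idem : hook0 * hook0 = hook0.
Proof.
apply: sat_inj => A B; split.
  case/sat_mul=> C /(sat_hook _ _ _ n1)[hA _ H] /(sat_hook _ _ _ n1)[_ hB H'].
  by apply/(sat_hook _ _ _ n1); split=> // j ji jS; rewrite H // H'.
move=> h; apply/sat_mul; exists A => //.
by case/(sat_hook _ _ _ n1): h => hA _ _; apply/(sat_hook _ _ _ n1).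
Qed.

(** * Elements of rank n - 2 *)

Lemma AJ_cases a : a \in AJ n -> (exists k, a = rho n ^+ k) \/
  (exists k s, s \in AJ n /\ a = rho n ^+ k * hook0 * s).
Proof.
pose P a := (exists k, a = rho n ^+ k) \/
  (exists k s, s \in AJ n /\ a = rho n ^+ k * hook0 * s).
pose T := [set a in AJ n | `[< P a >]].
have TE b : reflect (b \in AJ n /\ P b) (b \in T).
  rewrite [b \in T]inE; apply: (iffP andP) => -[bA Pb]; split=> //; exact/asboolP.
move=> aA; suff /subsetP/(_ a aA)/TE[] : AJ n \subset T by [].
apply: (@AJ_ind _ i0) => //.
- move=> b c /TE[bA Pb] /TE[cA Pc]; apply/TE; split; first exact: AJ_mul.
  case: Pb => [[k bE]|[k [s [sA bE]]]]; last first.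
    by right; exists k, (s * c); rewrite AJ_mul // bE !mulgA.
  case: Pc => [[l cE]|[l [s [sA cE]]]].
    by left; exists (k + l)%N; rewrite expgnDr bE cE.
  by right; exists (k + l)%N, s; rewrite expgnDr bE cE !mulgA.
- by apply/TE; split; [exact: (AJ_rho1 n 1) | left; exists 1%N].
apply/TE; split; first exact: AJ_hook0.
by right; exists 0%N, 1; rewrite AJ1 mul1g mulg1.
Qed.

Lemma rank_hook0_mul s : s \in AJ n -> (bip_rank (hook0 * s)%g <= n - 2)%N.
Proof. by move=> sA; rewrite -rank_hook0 rank_mulr ?AJ_hook0. Qed.

Lemma rank_lt_n a : a \in AJ n -> (exists k, a = rho n ^+ k) \/ (bip_rank a <= n - 2)%N.
Proof.
move=> aA; case: (AJ_cases aA) => [|[k [s [sA ->]]]]; first by left.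
have esA : hook0 * s \in AJ n by rewrite AJ_mul ?AJ_hook0.
by right; rewrite -(mulgA (rho n ^+ k) hook0 s) (rank_rhol k esA) rank_hook0_mul.
Qed.

Lemma rank_eq_n a : a \in AJ n -> bip_rank a = n -> exists k, a = rho n ^+ k.
Proof. by move=> aA r; case: (rank_lt_n aA) => //; rewrite r; lia. Qed.

(** All strings of [x] other than the two cups of the hook run through, so
    [x * x^-1] pairs every point as the hook does. *)
Lemma local_unit x : x \in AJ n -> hook0 * x = x -> bip_rank x = (n - 2)%N ->
  x * x^-1 = hook0.
Proof.
move=> xA ex rx; have /matesP[f xf] := AJ_matching xA.
have eh := mates_hook i0 n1.
have b_inv z w : same (x * x^-1) z w = same (x * x^-1) (flip z) (flip w).
  by rewrite -same_inv invgM invgK.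
have up : same (x * x^-1) (inl i0) (inl (ordS i0)).
  apply: same_mulr; rewrite -ex; apply: same_mulr.
  have := mates_samef eh (inl i0).
  by rewrite /hookf (@reconnect_fl _ _ (inr i0) (inr (ordS i0)) (@flip_neq n)).
have thr : through f = through (hookf i0).
  apply/eqP; rewrite eqEcard -(rank_mates eh) -(rank_mates xf) rx rank_hook0 leqnn andbT.
  by apply: (through_sub eh xf) => i k s; rewrite -ex; apply: same_mulr.
have across j : j != i0 -> j != ordS i0 -> same (x * x^-1) (inl j) (inr j).
  move=> ji jS; have : j \in through f by rewrite thr through_hook !inE ji jS.
  rewrite inE; case E: (f (inl j)) => [//|k] _; apply: (same_mulV (k := k)).
  by rewrite -E (mates_samef xf).
apply/esym/(mates_sub eh); first by apply/AJ_matching/AJ_mul => //; apply: AJ_inv.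
move=> z; case: (hookfP i0 z) => [->|->|-> _ _ _|-> _ _ _|].
- by rewrite b_inv.
- by rewrite same_sym b_inv.
- by [].
- by rewrite same_sym.
case: z => j zu zv zfu zfv _ _ _ _; first exact: across.
by rewrite same_sym; apply: across.
Qed.

(** In the finite monoid with identity [hook0], the right invertible element [x]
    has finite order. *)
Lemma local_power x : x \in AJ n -> hook0 * x = x -> x * hook0 = x ->
  bip_rank x = (n - 2)%N -> exists m, x ^+ m.+1 = hook0.
Proof.
move=> xA ex xe rx; have xy := local_unit xA ex rx.
have xke k : x ^+ k.+1 * hook0 = x ^+ k.+1 by rewrite expgSr -mulgA xe.
have key u v : u * x * (x^-1 * v) = u * hook0 * v by rewrite -xy !mulgA.
have xyk k : x ^+ k.+1 * x^-1 ^+ k.+1 = hook0.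
  by elim: k => // k IH; rewrite expgSr [x^-1 ^+ _]expgS key xke.
have [i [j [ij E]]] : exists i j, (i < j)%N /\ x ^+ i.+1 = x ^+ j.+1.
  pose g (i : 'I_#|{: bipart n}|.+1) := x ^+ i.+1.
  have : ~~ injectiveb g.
    by apply/negP=> /injectiveP/leq_card; rewrite card_ord ltnn.
  case/injectivePn=> i [j ij gE]; case: (ltngtP i j) => h.
  - by exists i, j.
  - by exists j, i.
  by case/eqP: ij; apply: val_inj.
exists (j - i).-1; rewrite prednK ?subn_gt0 //.
have <- : x ^+ (j - i) * hook0 = x ^+ (j - i).
  by rewrite -(prednK (n := (j - i)%N)) ?subn_gt0 // xke.
by rewrite -{1}(xyk i) mulgA -expgnDr addnS subnK ?(ltnW ij) // -E xyk.
Qed.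

Lemma rank_n2_gen a (T : {set bipart n}) : a \in AJ n -> bip_rank a = (n - 2)%N ->
  {in T &, forall b c, b * c \in T} -> rho n \in T -> a \in T -> hook0 \in T.
Proof.
move=> aA ra TM Tr Ta.
have TS x k : x \in T -> x ^+ k.+1 \in T.
  by move=> xT; elim: k => // k IH; rewrite expgS; apply: TM.
have TX k : rho n ^+ k \in T.
  case: k => [|k]; last exact: TS.
  by have := TS _ n.-1 Tr; rewrite prednK ?rho_expn // ltnW.
case: (AJ_cases aA) => [[k aE]|[k [s [sA aE]]]].
  by move: ra; rewrite aE rank_rho; lia.
have A0 := AJ_hook0.
have esA : hook0 * s \in AJ n by apply: AJ_mul.
have res : bip_rank (hook0 * s) = (n - 2)%N.
  by rewrite -ra aE -(mulgA (rho n ^+ k) hook0 s) (rank_rhol k esA).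
(* factoring the inverse yields a hook on the right as well *)
case: (AJ_cases (AJ_inv n1 esA)) => [[l E]|[l [t [tA E]]]].
  by move: res; rewrite -rank_inv ?AJ_matching // E rank_rho; lia.
have esE : hook0 * s = t^-1 * hook0 * rho n ^- l.
  by rewrite -[LHS]invgK E !invgM hookV // mulgA.
have lV : rho n ^- l * rho n ^+ l = 1.
  by rewrite -expVgn rhoV_exp -expgnA mulnC rhoVX.
pose x := hook0 * s * rho n ^+ l.
have xE : x = t^-1 * hook0 by rewrite /x esE -mulgA lV mulg1.
have xT : x \in T.
  have -> : x = rho n ^+ (k * n.-1) * a * rho n ^+ l.
    by rewrite aE /x !mulgA rhoVX mul1g.
  by apply: (TM) => //; apply: (TM).
have [||||m <-] := @local_power x; last exact: TS.
- by rewrite AJ_mul ?AJ_rho1.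
- by rewrite /x !mulgA hook0_idem.
- by rewrite xE -mulgA hook0_idem.
by rewrite rank_rhor.
Qed.

(** * Subsemigroups that omit the rotation *)

(** The exponents j with rho ^ j in M or equal to 1 are the multiples of the least
    positive one, which divides n and is not 1. *)
Lemma cyclic_prime (M : {set bipart n}) : {in M &, forall b c, b * c \in M} ->
  rho n \notin M -> exists2 p, p \in primes n & forall j, rho n ^+ j \in M -> (p %| j)%N.
Proof.
move=> MM Mr; have n0 : (0 < n)%N by apply: ltnW.
pose Q j := (rho n ^+ j == 1) || (rho n ^+ j \in M).
have QD j k : Q j -> Q k -> Q (j + k)%N.
  rewrite /Q expgnDr => /orP[/eqP->|jM]; first by rewrite mul1g.
  by case/orP=> [/eqP->|kM]; rewrite ?mulg1 ?jM ?orbT // MM ?orbT.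
have QM j m : Q j -> Q (j * m)%N.
  move=> Qj; elim: m => [|m IH]; first by rewrite muln0 /Q eqxx.
  by rewrite mulnS; apply: QD.
have Qmod j k : j = k %[mod n] -> Q j -> Q k by rewrite /Q => /rhoX_mod->.
have Qn : Q n by rewrite /Q rho_expn eqxx.
have exP : exists k, (0 < k)%N && Q k by exists n; rewrite n0.
case: (ex_minnP exP) => k /andP[k0 Qk] min.
have kdvd j : Q j -> (k %| j)%N.
  move=> Qj; rewrite /dvdn -leqn0 leqNgt; apply/negP=> r0.
  have Qr : Q (j %% k)%N.
    (* j + k (j / k) (n - 1) is congruent to j - k (j / k) modulo n *)
    apply: (@Qmod (j + k * (j %/ k * n.-1)))%N; last by apply: QD => //; apply: QM.
    have -> : (j + k * (j %/ k * n.-1) = j %% k + j %/ k * k * n)%N.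
      rewrite {1}(divn_eq j k) -addnA addnCA; congr (_ + _)%N.
      by rewrite mulnCA mulnA -mulnS prednK.
    by rewrite addnC modnMDl.
  by have := min _ (introT andP (conj r0 Qr)); rewrite leqNgt ltn_mod k0.
have k1 : k != 1%N.
  apply: contraTneq Qk => ->; rewrite /Q expg1 negb_or Mr andbT.
  apply/eqP=> E; have := @rhoX_eq n 1 0 n0; rewrite expg1 expg0 => /(_ E).
  by rewrite modn_small // mod0n.
exists (pdiv k).
  rewrite mem_primes n0 pdiv_prime ?(dvdn_trans (pdiv_dvd k)) ?kdvd //; lia.
by move=> j jM; apply: dvdn_trans (pdiv_dvd k) (kdvd _ _); rewrite /Q jM orbT.
Qed.
End Structure.

(** * Maximal subsemigroups and their types *)

Lemma mulset_subP n (T : {set bipart n}) :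
  reflect {in T &, forall a b, a * b \in T} (T * T \subset T).
Proof.
apply: (iffP subsetP) => [H a b aT bT|H x /mulsgP[a b aT bT ->]]; last exact: H.
by apply/H/mulsgP; exists a b.
Qed.

Lemma sgen1P n (y x : bipart n) :
  reflect (exists m, x = y ^+ m.+1) (x \in sgen [set y]).
Proof.
apply: (iffP bigcapP) => [H|[m ->] T /andP[yT /and3P[_ _ /mulset_subP TM]]].
  pose T := [set z : bipart n | `[< exists m, z = y ^+ m.+1 >]].
  have yT : y \in T by rewrite inE; apply/asboolP; exists 0%N.
  have := H T; rewrite sub1set yT /subsemigroup subsetT /=.
  have -> : T != set0 by apply/set0Pn; exists y.
  move=> /(_ _)/[!inE] h; apply/asboolP/h; apply/mulset_subP=> a b; rewrite !inE.
  move=> /asboolP[k ->] /asboolP[l ->]; apply/asboolP; exists (k + l.+1)%N.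
  by rewrite -addSn expgnDr.
have {}yT : y \in T by rewrite sub1set in yT.
by elim: m => // m IH; rewrite expgS; apply: TM.
Qed.

(** The exponent 0 is allowed since [rho n ^+ d] has finite order. *)
Lemma sgen_rhoP n d x : (0 < n)%N ->
  reflect (exists m, x = rho n ^+ (d * m)) (x \in sgen [set rho n ^+ d]).
Proof.
move=> n0; apply: (iffP (sgen1P _ _)) => -[m ->].
  by exists m.+1; rewrite expgnA.
exists (m + n.-1)%N; rewrite -addnS prednK // -expgnA.
by apply: rhoX_mod; rewrite mulnDr addnC modnMDl.
Qed.

Lemma AJ_mulset3P n (a x : bipart n) :
  reflect (exists u v, [/\ u \in AJ n, v \in AJ n & x = u * a * v])
    (x \in AJ n * [set a] * AJ n).
Proof.
apply: (iffP mulsgP) => [[_ v /mulsgP[u _ uA /set1P-> ->] vA ->]|[u [v [uA vA ->]]]].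
  by exists u, v.
by exists (u * a) v => //; apply/mulsgP; exists u a; rewrite ?set11.
Qed.

Section Main.
Variables (n : nat) (n1 : (1 < n)%N).
Let n0 : (0 < n)%N := ltnW n1.
Implicit Types (a b : bipart n) (M T : {set bipart n}).

Lemma green_J_P a b : reflect
  ((exists u v, [/\ u \in AJ n, v \in AJ n & a = u * b * v]) /\
   (exists u v, [/\ u \in AJ n, v \in AJ n & b = u * a * v]))
  (green_J (AJ n) a b).
Proof.
have sub c d : (exists u v, [/\ u \in AJ n, v \in AJ n & c = u * d * v]) ->
    AJ n * [set c] * AJ n \subset AJ n * [set d] * AJ n.
  move=> [u [v [uA vA ->]]]; apply/subsetP=> x /AJ_mulset3P[s [t [sA tA ->]]].
  apply/AJ_mulset3P; exists (s * u), (v * t); rewrite !AJ_mul //; split=> //.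
  by rewrite !mulgA.
have self c : c \in AJ n * [set c] * AJ n.
  by apply/AJ_mulset3P; exists 1, 1; rewrite !AJ1 mul1g mulg1.
apply: (iffP eqP) => [E|[ab ba]].
  by split; apply/AJ_mulset3P; [rewrite -E | rewrite E].
by apply/eqP; rewrite eqEsubset !sub.
Qed.

(** The subsemigroups of the classification: one for each prime divisor [d] of
    [n], and the complement of the elements of rank [n - 2]. *)
Definition Ma d := (AJ n :\: sgen [set rho n]) :|: sgen [set rho n ^+ d].
Definition Mb := AJ n :\: [set a in AJ n | bip_rank a == (n - 2)%N].

Lemma rho_genP a : reflect (exists k, a = rho n ^+ k) (a \in sgen [set rho n]).
Proof.
rewrite -[X in [set X]](expg1 (rho n)).
by apply: (iffP (sgen_rhoP 1 a n0)) => -[k ->]; exists k; rewrite ?mul1n.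
Qed.

Lemma rho_gen_rank a : a \in AJ n -> (a \in sgen [set rho n]) = (bip_rank a == n).
Proof.
move=> aA; apply/rho_genP/eqP => [[k ->]|]; first exact: rank_rho.
exact: rank_eq_n.
Qed.

Lemma rank_neq a : a \in AJ n -> bip_rank a != n -> (bip_rank a <= n - 2)%N.
Proof.
move=> aA; case: (rank_lt_n n1 aA) => // -[k ->].
by rewrite rank_rho // eqxx.
Qed.

Lemma MaP d a : reflect
  (a \in AJ n /\ (bip_rank a == n -> exists m, a = rho n ^+ (d * m))) (a \in Ma d).
Proof.
apply: (iffP setUP).
  case=> [/setDP[aA]|/(sgen_rhoP _ _ n0)[m ->]].
    by rewrite rho_gen_rank // => /negPf ->.
  by split; [apply: AJ_rho1 | exists m].
case=> aA H; case E: (bip_rank a == n); last by left; rewrite in_setD rho_gen_rank // E.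
by right; apply/sgen_rhoP => //; apply: H.
Qed.

Lemma MbP a : reflect (a \in AJ n /\ bip_rank a != (n - 2)%N) (a \in Mb).
Proof.
rewrite in_setD [a \in [set _ in _ | _]]inE.
by apply: (iffP andP) => -[]; case: (a \in AJ n).
Qed.

Lemma rho_Ma d j : d \in primes n -> rho n ^+ j \in Ma d -> (d %| j)%N.
Proof.
rewrite mem_primes => /and3P[_ _ dn] /MaP[_]; rewrite rank_rho // eqxx => /(_ isT)[m].
move/(rhoX_eq n0) => E; rewrite /dvdn -(modn_dvdm _ dn) E modn_dvdm //.
by rewrite modnMr.
Qed.

Lemma hook0_Ma d : hook0 n1 \in Ma d.
Proof. by apply/MaP; rewrite AJ_hook0 rank_hook0; split=> //; lia. Qed.

Lemma rho_notin_Ma d : d \in primes n -> rho n \notin Ma d.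
Proof.
move=> dP; apply/negP; rewrite -[rho n]expg1 => /(rho_Ma dP).
by move: dP; rewrite dvdn1 mem_primes => /andP[/prime_gt1]; case: eqP => // ->.
Qed.

Lemma rho_Mb : rho n \in Mb.
Proof.
by apply/MbP; rewrite -[rho n]expg1 AJ_rho1 rank_rho //; split=> //; lia.
Qed.

Definition proper_sub T := subsemigroup (AJ n) T && (T \proper AJ n).

(** A subsemigroup of S is proper unless it contains both generators. *)
Lemma proper_subP T : reflect
  [/\ T != set0, T \subset AJ n, {in T &, forall a b, a * b \in T}
    & ~~ ((rho n \in T) && (hook0 n1 \in T))] (proper_sub T).
Proof.
rewrite /proper_sub /subsemigroup properE.
apply: (iffP andP) => [[/and3P[T0 TA /mulset_subP TM] /andP[_ TnA]]|[T0 TA TM Tn]].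
  split=> //; apply: contra TnA => /andP[Tr Th]; exact: AJ_ind Th.
rewrite T0 TA; split; first exact/mulset_subP.
apply: contra Tn => /subsetP AT.
by rewrite -[rho n]expg1 !AT ?AJ_rho1 ?AJ_hook0.
Qed.

Lemma proper_Ma d : d \in primes n -> proper_sub (Ma d).
Proof.
move=> dP; apply/proper_subP; split.
- by apply/set0Pn; exists (hook0 n1); apply: hook0_Ma.
- by apply/subsetP=> a /MaP[].
- move=> a b /MaP[aA Ha] /MaP[bA Hb]; apply/MaP; rewrite AJ_mul //; split=> //.
  move/eqP=> r; have := rank_mulr n1 aA bA; have := rank_mull n1 aA bA.
  rewrite r => rb ra.
  have /eqP/Ha[k ->] : bip_rank a = n.
    by apply/eqP; rewrite eqn_leq ra rank_le ?AJ_matching.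
  have /eqP/Hb[l ->] : bip_rank b = n.
    by apply/eqP; rewrite eqn_leq rb rank_le ?AJ_matching.
  by exists (k + l)%N; rewrite mulnDr expgnDr.
by rewrite (negPf (rho_notin_Ma dP)).
Qed.

Lemma proper_Mb : proper_sub Mb.
Proof.
apply/proper_subP; split.
- by apply/set0Pn; exists (rho n); apply: rho_Mb.
- by apply/subsetP=> a /MbP[].
- move=> a b /MbP[aA ra] /MbP[bA rb]; apply/MbP; rewrite AJ_mul //; split=> //.
  have lea := rank_mulr n1 aA bA; have leb := rank_mull n1 aA bA.
  case: (eqVneq (bip_rank a) n) => [/(rank_eq_n n1 aA)[k ->]|/(rank_neq aA) h].
    by rewrite rank_rhol.
  by apply/eqP => r; move: lea h ra; rewrite r; lia.
by apply/negP=> /andP[_ /MbP[_]]; rewrite rank_hook0 eqxx.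
Qed.

Lemma proper_sub_Ma T : proper_sub T -> rho n \notin T ->
  exists p, [/\ p \in primes n, T \subset Ma p
    & forall j, rho n ^+ j \in T -> (p %| j)%N].
Proof.
case/proper_subP=> _ /subsetP TA TM _ Tr.
have [p pP H] := cyclic_prime n1 TM Tr; exists p; split=> //.
apply/subsetP=> a aT; apply/MaP; split; first exact: TA.
move/eqP=> r; case: (rank_eq_n n1 (TA _ aT) r) => k aE.
have /dvdnP[m km] : (p %| k)%N by apply: H; rewrite -aE.
by exists m; rewrite aE km mulnC.
Qed.

Lemma proper_sub_Mb T : proper_sub T -> rho n \in T -> T \subset Mb.
Proof.
case/proper_subP=> _ /subsetP TA TM nT Tr; rewrite Tr /= in nT.
apply/subsetP=> a aT; apply/MbP; split; first exact: TA.
by apply: contra nT => /eqP r; exact: (rank_n2_gen n1 (TA _ aT) r TM Tr aT).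
Qed.

Lemma maximal_Ma d : d \in primes n -> maximal_subsemigroup (AJ n) (Ma d).
Proof.
move=> dP; apply/maxsetP; split=> [|T pT MT]; first exact: proper_Ma.
have Tr : rho n \notin T.
  case/proper_subP: (pT) => _ _ _.
  by rewrite [hook0 n1 \in T](subsetP MT) ?hook0_Ma ?andbT.
have [p [pP Tp H]] := proper_sub_Ma pT Tr.
have pd : (p %| d)%N.
  by apply/H/(subsetP MT)/MaP; rewrite AJ_rho1; split=> // _; exists 1%N; rewrite muln1.
move: (pP) (dP); rewrite !mem_primes => /andP[pp _] /andP[dp _].
move: pd; rewrite dvdn_prime2 // => /eqP pd.
by apply/eqP; rewrite eqEsubset MT andbT -pd.
Qed.

Lemma maximal_Mb : maximal_subsemigroup (AJ n) Mb.
Proof.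
apply/maxsetP; split=> [|T pT MT]; first exact: proper_Mb.
by apply/eqP; rewrite eqEsubset MT andbT proper_sub_Mb // (subsetP MT) ?rho_Mb.
Qed.

Lemma maximal_subsemigroups M : maximal_subsemigroup (AJ n) M <->
  (exists2 d, d \in primes n & M = Ma d) \/ M = Mb.
Proof.
split=> [/maxsetP[pM max]|[[d dP ->]|->]]; last 2 first.
- exact: maximal_Ma.
- exact: maximal_Mb.
case: (boolP (rho n \in M)) => Mr.
  by right; apply/esym/max; [apply: proper_Mb | apply: proper_sub_Mb].
have [p [pP Mp _]] := proper_sub_Ma pM Mr.
by left; exists p => //; apply/esym/max => //; apply: proper_Ma.
Qed.

Lemma regular_AJ (J : {set bipart n}) : J \subset AJ n -> regular (AJ n) J.
Proof.
move/subsetP=> JA; apply/forall_inP=> a /JA aA; apply/existsP; exists a^-1.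
by rewrite AJ_inv // mul_invgK eqxx.
Qed.

Lemma rank_mul3 u a v : u \in AJ n -> a \in AJ n -> v \in AJ n ->
  (bip_rank (u * a * v)%g <= bip_rank a)%N.
Proof.
move=> uA aA vA; apply: leq_trans (rank_mulr n1 (AJ_mul n1 uA aA) vA) _.
exact: rank_mull.
Qed.

Lemma J_class_rho : sgen [set rho n] \in J_classes (AJ n).
Proof.
apply/imsetP; exists 1; first exact: AJ1.
apply/setP=> b; rewrite [RHS]inE; apply/idP/andP.
  case/rho_genP=> k ->; have R := AJ_rho1 n; split=> //; apply/green_J_P; split.
    by exists (rho n ^+ (k * n.-1)), 1; rewrite AJ1 mulg1 rhoVX.
  by exists (rho n ^+ k), 1; rewrite AJ1 !mulg1.
case=> bA /green_J_P[[u [v [uA vA E]]] _]; rewrite rho_gen_rank //.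
rewrite eqn_leq rank_le ?AJ_matching //= -{1}(rank_one n) E.
exact: rank_mul3.
Qed.

(** By [rank_n2_gen], [hook0] lies in the ideal of S generated by any element of
    rank n - 2. *)
Lemma J_class_rank_n2 :
  [set a in AJ n | bip_rank a == (n - 2)%N] \in J_classes (AJ n).
Proof.
have hA := AJ_hook0 n1.
apply/imsetP; exists (hook0 n1) => //.
apply/setP=> b; rewrite [LHS]inE [RHS]inE; case bA: (b \in AJ n) => //=.
apply/eqP/green_J_P => [r|[[u [v [uA vA E]]] [s [t [sA tA E']]]]].
  split.
    pose T := sgen [set rho n] :|: AJ n * [set b] * AJ n.
    have : hook0 n1 \in T.
      apply: (rank_n2_gen n1 bA r).
      - move=> c d /setUP[/rho_genP[k ->]|/AJ_mulset3P[u [v [uA vA ->]]]].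
          case/setUP=> [/rho_genP[l ->]|/AJ_mulset3P[u [v [uA vA ->]]]].
            by apply/setUP; left; apply/rho_genP; exists (k + l)%N; rewrite expgnDr.
          apply/setUP; right; apply/AJ_mulset3P; exists (rho n ^+ k * u), v.
          by rewrite AJ_mul ?AJ_rho1 // !mulgA.
        move=> dT; have dA : d \in AJ n.
          case/setUP: dT => [/rho_genP[l ->]|/AJ_mulset3P[s [t [sA tA ->]]]].
            exact: AJ_rho1.
          by rewrite !AJ_mul.
        apply/setUP; right; apply/AJ_mulset3P; exists u, (v * d).
        by rewrite AJ_mul // !mulgA.
      - by apply/setUP; left; apply/rho_genP; exists 1%N.
      apply/setUP; right; apply/AJ_mulset3P; exists 1, 1.
      by rewrite AJ1 mul1g mulg1.
    case/setUP=> [|/AJ_mulset3P//]; rewrite rho_gen_rank // rank_hook0; lia.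
  case: (AJ_cases n1 bA) => [[k bE]|[k [s [sA ->]]]].
    by move: r; rewrite bE rank_rho //; lia.
  by exists (rho n ^+ k), s; rewrite AJ_rho1.
apply/eqP; rewrite eqn_leq -(rank_hook0 n1) {1}E'.
by rewrite rank_mul3 //= [X in bip_rank X]E rank_mul3.
Qed.

Lemma type_M5_Ma d : type_M5 (AJ n) (Ma d).
Proof.
have GA : sgen [set rho n] \subset AJ n.
  by apply/subsetP=> a /rho_genP[k ->]; apply: AJ_rho1.
apply/existsP; exists (sgen [set rho n]); apply/and3P; split.
- rewrite /arises_from J_class_rho; apply/subsetP=> a.
  rewrite in_setD => /andP[aM aA]; apply: contraR aM => aG.
  by apply/setUP; left; apply/setDP.
- exact: regular_AJ.
apply/forall_inP=> _ /imsetP[x xA ->]; apply/implyP=> /subsetP H.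
have /rho_genP[k xE] : x \in sgen [set rho n].
  by apply: H; rewrite inE xA /green_H /green_L /green_R !eqxx.
have R := AJ_rho1 n.
(* the H-class lies in the group of units, so it contains 1 *)
apply/set0Pn; exists 1; rewrite !in_setI -andbA; apply/and3P; split.
- by apply/MaP; split; [exact: AJ1 | exists 0%N; rewrite muln0].
- by apply/rho_genP; exists 0%N.
rewrite inE AJ1 /=; apply/andP; split.
  apply/eqP/setP=> y; apply/mulsgP/mulsgP => -[s _ sA /set1P-> ->].
    by exists (s * x) 1; rewrite ?set11 ?mulg1 ?AJ_mul.
  exists (s * rho n ^+ (k * n.-1)) x; rewrite ?set11 ?AJ_mul //.
  by rewrite xE -mulgA rhoVX.
apply/eqP/setP=> y; apply/mulsgP/mulsgP => -[_ s /set1P-> sA ->].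
  by exists 1 (x * s); rewrite ?set11 ?mul1g ?AJ_mul.
exists x (rho n ^+ (k * n.-1) * s); rewrite ?set11 ?AJ_mul //.
by rewrite xE mulgA rhoXV.
Qed.

Lemma type_M1_Mb : type_M1 (AJ n) Mb.
Proof.
set J := [set a in AJ n | bip_rank a == (n - 2)%N].
have JA : J \subset AJ n by apply/subsetP=> a; rewrite inE => /andP[].
apply/existsP; exists J; apply/and3P; split; last 2 first.
- exact: regular_AJ.
- by apply/eqP/setP=> a; rewrite in_setI in_setD -/J in_set0 andbAC andNb.
rewrite /arises_from J_class_rank_n2; apply/subsetP=> a.
by rewrite !in_setD => /andP[aM aA]; move: aM; rewrite aA andbT negbK.
Qed.

Lemma card_maximal_subsemigroups :
  #|[set M | maximal_subsemigroup (AJ n) M]| = (size (primes n) + 1)%N.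
Proof.
have -> : [set M | maximal_subsemigroup (AJ n) M] = [set M in Mb :: map Ma (primes n)].
  apply/setP=> M; rewrite !inE; apply/idP/orP.
    by case/maximal_subsemigroups=> [[d dP ->]|->]; [right; apply: map_f | left].
  by case=> [/eqP->|/mapP[d dP ->]]; [apply: maximal_Mb | apply: maximal_Ma].
rewrite cardsE; have /card_uniqP -> : uniq (Mb :: map Ma (primes n)).
  rewrite /=; apply/andP; split.
    by apply/mapP=> -[d dP E]; have := rho_notin_Ma dP; rewrite -E rho_Mb.
  rewrite map_inj_in_uniq ?primes_uniq // => d p dP pP E.
  have : (p %| d)%N.
    apply: (rho_Ma pP); rewrite -E; apply/MaP; rewrite AJ_rho1.
    by split=> // _; exists 1%N; rewrite muln1.
  move: dP pP; rewrite !mem_primes => /andP[dp _] /andP[pp _].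
  by rewrite dvdn_prime2 // => /eqP.
by rewrite /= size_map addn1.
Qed.
End Main.

Theorem theorem4p9 (n : nat) (hn : (2 <= n)%N) :
  let Ma d := (AJ n :\: sgen [set rho n]) :|: sgen [set rho n ^+ d] in
  let Mb := AJ n :\: [set a in AJ n | bip_rank a == (n - 2)%N] in
  [/\ forall M : {set bipart n},
        maximal_subsemigroup (AJ n) M <->
        (exists2 d, d \in primes n & M = Ma d) \/ M = Mb,
      forall d, d \in primes n -> type_M5 (AJ n) (Ma d),
      type_M1 (AJ n) Mb
    & #|[set M | maximal_subsemigroup (AJ n) M]| = (size (primes n) + 1)%N].
Proof.
split.
- exact: maximal_subsemigroups.
- by move=> d _; apply: type_M5_Ma.
- exact: type_M1_Mb.
exact: card_maximal_subsemigroups.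
Qed.
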